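(* Let $B$ be a commutative algebra with a left action of a group $\Gamma$, let $\gamma_1,\dots,\gamma_n\in\Gamma$, $\nabla=\mathrm{diag}(\gamma_1,\dots,\gamma_n)\in M_n(B\rtimes\Gamma)$, and let $F\in GL_n(B)$ be $\nabla$-odd, i.e. $\nabla F\nabla\in M_n(B)$. Let $A^B_{\mathrm o}(\nabla,F)$ be the universal $(B,\Gamma)$-algebra with an invertible matrix $v\in GL_n(A^B_{\mathrm o}(\nabla,F))$ such that $v_{ij}$ has degree $(\gamma_i,\gamma_j)$ for all $i,j$ and $r_n(\nabla F\nabla)\,v^{-\mathsf T}=v\,s_n(F)$. Then $A^B_{\mathrm o}(\nabla,F)$ can be equipped with a unique structure $(\Delta,\epsilon,S)$ of a $(B,\Gamma)$-Hopf algebroid such that $v$ becomes a matrix corepresentation, i.e. $\Delta(v_{ij})=\sum_k v_{ik}\tilde\otimes v_{kj}$, $\epsilon(v_{ij})=\delta_{i,j}\gamma_i$ and $S(v_{ij})=(v^{-1})_{ij}$ for all $i,j$.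
   Context: All algebras and homomorphisms are unital over a fixed ground field. $B$ is a commutative algebra on which the group $\Gamma$ acts from the left by automorphisms; $e\in\Gamma$ is the unit. A $(B,\Gamma)$-algebra is an algebra $A$ with a grading $A=\bigoplus_{\gamma,\gamma'\in\Gamma}A_{\gamma,\gamma'}$ (with $A_{\gamma,\gamma'}A_{\beta,\beta'}\subseteq A_{\gamma\beta,\gamma'\beta'}$) and homomorphisms $r,s\colon B\to A_{e,e}$ with commuting images such that $a\,r(b)=r(\gamma(b))a$ and $a\,s(b)=s(\gamma'(b))a$ for all $a\in A_{\gamma,\gamma'}$, $b\in B$. Morphisms are grading-preserving homomorphisms compatible with $r$ and $s$. The crossed product $B\rtimes\Gamma$ is spanned by elements $b\gamma$ with $b\gamma\cdot b'\gamma'=b\gamma(b')\gamma\gamma'$; it is a $(B,\Gamma)$-algebra with $b\gamma$ in degree $(\gamma,\gamma)$ and $r(b)=s(b)=b$. $M_n(B)$ is viewed inside $M_n(B\rtimes\Gamma)$. Fiber product: for $(B,\Gamma)$-algebras $A,C$ let $A\overset{\Gamma}{\otimes}C=\sum_{\gamma,\gamma',\gamma''}A_{\gamma,\gamma'}\otimes C_{\gamma',\gamma''}\subseteq A\otimes C$, and let $A\tilde\otimes C$ be its quotient by the ideal generated by $\{s_A(b)\otimes1-1\otimes r_C(b):b\in B\}$. It is a $(B,\Gamma)$-algebra with $A_{\gamma,\gamma'}\tilde\otimes C_{\gamma',\gamma''}$ in degree $(\gamma,\gamma'')$ and $r(b)=r_A(b)\tilde\otimes1$, $s(b)=1\tilde\otimes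 s_C(b)$; $a\tilde\otimes c$ denotes the class of $a\otimes c$. It is functorial and associative, and $(B\rtimes\Gamma)\tilde\otimes A\cong A$ via $b\gamma\tilde\otimes a\mapsto r(b)a$, $A\tilde\otimes(B\rtimes\Gamma)\cong A$ via $a\tilde\otimes b\gamma\mapsto s(b)a$. $A^{\mathsf{co},\mathsf{op}}$ is the opposite algebra of $A$ with $(A^{\mathsf{co},\mathsf{op}})_{\gamma,\gamma'}=A_{\gamma'^{-1},\gamma^{-1}}$, $r_{A^{\mathsf{co},\mathsf{op}}}=s_A$, $s_{A^{\mathsf{co},\mathsf{op}}}=r_A$. A $(B,\Gamma)$-Hopf algebroid is a $(B,\Gamma)$-algebra $A$ with morphisms of $(B,\Gamma)$-algebras $\Delta\colon A\to A\tilde\otimes A$, $\epsilon\colon A\to B\rtimes\Gamma$, $S\colon A\to A^{\mathsf{co},\mathsf{op}}$ such that $(\Delta\tilde\otimes\mathrm{id})\Delta=(\mathrm{id}\tilde\otimes\Delta)\Delta$, $(\epsilon\tilde\otimes\mathrm{id})\Delta=\mathrm{id}=(\mathrm{id}\tilde\otimes\epsilon)\Delta$ (using the isomorphisms above), and, writing $\Delta(a)=\sum a_{(1)}\tilde\otimes a_{(2)}$, $\sum S(a_{(1)})a_{(2)}=\check s(\epsilon(a))$ and $\sum a_{(1)}S(a_{(2)})=\hat r(\epsilon(a))$ for all $a\in A$, where $\check s,\hat r\colon B\rtimes\Gamma\to A$ are the linear maps $\check s(\gamma b)=s(b)$, $\hat r(b\gamma)=r(b)$. For a linear map $\phi$,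 $\phi_n$ denotes its entrywise extension to $n\times n$-matrices. $v^{-\mathsf T}:=(v^{-1})^{\mathsf T}$ is the transpose of the inverse. *)

(* Defs.v *)
From HB Require Import structures.
From mathcomp Require Import all_boot all_algebra.
From mathcomp Require Import boolp.

Set Implicit Arguments.
Unset Strict Implicit.
Unset Printing Implicit Defensive.

Import GRing.Theory.
Local Open Scope ring_scope.
Local Open Scope quotient_scope.

(* Unital k-algebras, given by their central structure map and possibly zero:
   the library's algType excludes the zero algebra, but a fiber product of
   nonzero algebras can vanish. *)
HB.mixin Record isPzAlgebra (k : pzRingType) A of GRing.PzRing A := {
  in_pzalg : {rmorphism k -> A};
  in_pzalgC : forall (c : k) (x : A), in_pzalg c * x = x * in_pzalg c
}.

#[short(type="pzAlgType")]
HB.structure Definition PzAlgebra (k : pzRingType) :=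
  {A of GRing.PzRing A & isPzAlgebra k A}.

#[short(type="comPzAlgType")]
HB.structure Definition ComPzAlgebra (k : pzRingType) :=
  {A of GRing.ComPzRing A & isPzAlgebra k A}.

Arguments in_pzalg {k s}.

Definition alg_hom (k : pzRingType) (A C : pzAlgType k) (f : A -> C) : Prop :=
  [/\ zmod_morphism f, monoid_morphism f &
      forall c : k, f (in_pzalg c) = in_pzalg c].

Lemma zmod_morphism0 (U V : zmodType) (f : U -> V) : zmod_morphism f -> f 0 = 0.
Proof. by move=> h; rewrite -(subrr (0 : U)) h subrr. Qed.
Lemma zmod_morphismN (U V : zmodType) (f : U -> V) :
  zmod_morphism f -> {morph f : x / - x}.
Proof. by move=> h x; rewrite -sub0r h (zmod_morphism0 h) sub0r. Qed.
Lemma zmod_morphismD (U V : zmodType) (f : U -> V) :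
  zmod_morphism f -> {morph f : x y / x + y}.
Proof. by move=> h x y; rewrite -{1}[y]opprK h (zmod_morphismN h) opprK. Qed.
Lemma zmod_morphism_sum (U V : zmodType) (f : U -> V) I (r : seq I)
  (E : I -> U) : zmod_morphism f -> f (\sum_(i <- r) E i) = \sum_(i <- r) f (E i).
Proof.
move=> h; pose g : {additive U -> V} :=
  HB.pack f (GRing.isZmodMorphism.Build _ _ _ h).
exact: (raddf_sum g).
Qed.

Section HomTheory.
Variables (k : pzRingType) (A C : pzAlgType k) (f : A -> C).
Hypothesis h : alg_hom f.
Lemma alg_hom0 : f 0 = 0.
Proof. by have [hB _ _] := h; rewrite -(subrr (0 : A)) hB subrr. Qed.
Lemma alg_homN : {morph f : x / - x}.
Proof. by move=> x; have [hB _ _] := h; rewrite -sub0r hB alg_hom0 sub0r. Qed.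
Lemma alg_homB : {morph f : x y / x - y}.
Proof. by case: h. Qed.
Lemma alg_homD : {morph f : x y / x + y}.
Proof. by move=> x y; rewrite -{1}[y]opprK alg_homB alg_homN opprK. Qed.
Lemma alg_hom1 : f 1 = 1.
Proof. by have [_ [h1 _] _] := h. Qed.
Lemma alg_homM : {morph f : x y / x * y}.
Proof. by have [_ [_ hM] _] := h. Qed.
Lemma alg_homK c : f (in_pzalg c) = in_pzalg c.
Proof. by case: h. Qed.
End HomTheory.

(* A presentation of a k-algebra by multiplicative symbols: elements are finite
   sums of symbols, and two sums are identified when every admissible map into
   an abelian group takes the same value on them.  Taking the balanced
   biadditive maps on pairs as admissible gives the tensor product over k;
   taking the maps on pairs (b, g) that are additive in b gives the crossed
   product. *)
Record symbols (k : pzRingType) := Symbols {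
  sym :> choiceType;
  sym1 : sym;
  symM : sym -> sym -> sym;
  symN : sym -> sym;
  symK : k -> sym;
  admissible : forall V : zmodType, (sym -> V) -> Prop;
  symMA : associative symM;
  sym1M : left_id sym1 symM;
  symM1 : right_id sym1 symM;
  symKC : forall c x, symM (symK c) x = symM x (symK c);
  symK1 : symK 1 = sym1;
  symKM : forall b c, symK (b * c) = symM (symK b) (symK c);
  admissibleN : forall V phi x, @admissible V phi -> phi (symN x) = - phi x;
  admissibleKD : forall V phi b c, @admissible V phi ->
    phi (symK (b + c)) = phi (symK b) + phi (symK c);
  admissibleMl : forall V phi x,
    @admissible V phi -> @admissible V (fun y => phi (symM x y));
  admissibleMr : forall V phi y,
    @admissible V phi -> @admissible V (fun x => phi (symM x y))
}.

Section SymbolAlgebra.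
Variables (k : pzRingType) (X : symbols k).
Implicit Types (l : seq X) (V : zmodType).

Definition sum_equiv l l' : bool :=
  `[< forall V (phi : X -> V), admissible phi ->
      \sum_(x <- l) phi x = \sum_(x <- l') phi x >].

Lemma sum_equiv_refl : reflexive sum_equiv.
Proof. by move=> l; apply/asboolP. Qed.
Lemma sum_equiv_sym : symmetric sum_equiv.
Proof.
by move=> l l'; apply/asboolP/asboolP => h V phi a; rewrite h.
Qed.
Lemma sum_equiv_trans : transitive sum_equiv.
Proof.
move=> l2 l1 l3 /asboolP h /asboolP h'; apply/asboolP => V phi a.
by rewrite h // h'.
Qed.

Canonical sum_equiv_rel :=
  EquivRel sum_equiv sum_equiv_refl sum_equiv_sym sum_equiv_trans.

Definition symalg := {eq_quot sum_equiv}.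
HB.instance Definition _ := EqQuotient.on symalg.
HB.instance Definition _ := Choice.on symalg.

Definition sympure (x : X) : symalg := \pi_symalg [:: x].

(* The additive map induced by an admissible phi (junk otherwise). *)
Definition symlift V (phi : X -> V) (u : symalg) : V :=
  \sum_(x <- repr u) phi x.

Lemma symlift_pi V (phi : X -> V) l :
  admissible phi -> symlift phi (\pi_symalg l) = \sum_(x <- l) phi x.
Proof.
move=> a; have : sum_equiv (repr (\pi_symalg l)) l.
  by apply/eqquotP; exact: (reprK (\pi_symalg l)).
by move=> /asboolP; apply.
Qed.

Lemma symalg_ext (u w : symalg) :
  (forall V (phi : X -> V), admissible phi -> symlift phi u = symlift phi w) ->
  u = w.
Proof.
move=> h; rewrite -[u]reprK -[w]reprK; apply/eqquotP/asboolP => V phi a.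
exact: h.
Qed.

Definition symalg_zero : symalg := \pi_symalg [::].
Definition symalg_add (u w : symalg) : symalg := \pi_symalg (repr u ++ repr w).
Definition symalg_opp (u : symalg) : symalg :=
  \pi_symalg [seq symN x | x <- repr u].
Definition symalg_one : symalg := sympure (sym1 X).
Definition symalg_mul (u w : symalg) : symalg :=
  \pi_symalg [seq symM x y | x <- repr u, y <- repr w].

Section Lift.
Variables (V : zmodType) (phi : X -> V).
Hypothesis a : admissible phi.

Lemma symlift0 : symlift phi symalg_zero = 0.
Proof. by rewrite symlift_pi // big_nil. Qed.
Lemma symliftD u w :
  symlift phi (symalg_add u w) = symlift phi u + symlift phi w.
Proof. by rewrite symlift_pi // big_cat. Qed.
Lemma symliftN u : symlift phi (symalg_opp u) = - symlift phi u.
Proof.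
rewrite symlift_pi // big_map -sumrN; apply: eq_bigr => x _.
exact: admissibleN.
Qed.
Lemma symlift_pure x : symlift phi (sympure x) = phi x.
Proof. by rewrite symlift_pi // big_seq1. Qed.
Lemma symliftM u w : symlift phi (symalg_mul u w) =
  \sum_(x <- repr u) \sum_(y <- repr w) phi (symM x y).
Proof. by rewrite symlift_pi // big_allpairs_dep. Qed.
Lemma symliftMl x u :
  symlift (fun y => phi (symM x y)) u = \sum_(y <- repr u) phi (symM x y).
Proof. by []. Qed.
Lemma symliftMr y u :
  symlift (fun x => phi (symM x y)) u = \sum_(x <- repr u) phi (symM x y).
Proof. by []. Qed.
End Lift.

Ltac by_lift :=
  apply: symalg_ext => V phi ?;
  rewrite ?(symlift0, symliftD, symliftN, symlift_pure) //.

Lemma symalg_addA : associative symalg_add.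
Proof. by move=> ? ? ?; by_lift; rewrite addrA. Qed.
Lemma symalg_addC : commutative symalg_add.
Proof. by move=> ? ?; by_lift; rewrite addrC. Qed.
Lemma symalg_add0 : left_id symalg_zero symalg_add.
Proof. by move=> ?; by_lift; rewrite add0r. Qed.
Lemma symalg_addN : left_inverse symalg_zero symalg_opp symalg_add.
Proof. by move=> ?; by_lift; rewrite addNr. Qed.

HB.instance Definition _ := GRing.isZmodule.Build symalg
  symalg_addA symalg_addC symalg_add0 symalg_addN.

Lemma symalg_mulA : associative symalg_mul.
Proof.
move=> u v w; apply: symalg_ext => V phi a; rewrite !symliftM //.
under eq_bigr => x _.
  rewrite -symliftMl symliftM; last exact: admissibleMl.
  over.
rewrite [RHS]exchange_big.
under [in RHS]eq_bigr => z _.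
  rewrite -symliftMr symliftM; last exact: admissibleMr.
  over.
rewrite [RHS]exchange_big; apply: eq_bigr => x _.
rewrite [RHS]exchange_big; apply: eq_bigr => y _.
by apply: eq_bigr => z _; rewrite symMA.
Qed.

Lemma symalg_mul1l : left_id symalg_one symalg_mul.
Proof.
move=> u; apply: symalg_ext => V phi a; rewrite symliftM // exchange_big.
apply: eq_bigr => x _; rewrite -symliftMr.
by rewrite symlift_pure ?sym1M //; apply: admissibleMr.
Qed.

Lemma symalg_mul1r : right_id symalg_one symalg_mul.
Proof.
move=> u; apply: symalg_ext => V phi a; rewrite symliftM //.
apply: eq_bigr => x _; rewrite -symliftMl.
by rewrite symlift_pure ?symM1 //; apply: admissibleMl.
Qed.

Lemma symalg_mulDl : left_distributive symalg_mul symalg_add.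
Proof.
move=> u v w; apply: symalg_ext => V phi a; rewrite symliftD // !symliftM //.
rewrite exchange_big [X in X + _]exchange_big [X in _ + X]exchange_big.
rewrite -big_split; apply: eq_bigr => x _ /=.
by have := symliftD (admissibleMr x a) u v; apply.
Qed.

Lemma symalg_mulDr : right_distributive symalg_mul symalg_add.
Proof.
move=> u v w; apply: symalg_ext => V phi a; rewrite symliftD // !symliftM //.
rewrite -big_split; apply: eq_bigr => x _ /=.
by have := symliftD (admissibleMl x a) v w; apply.
Qed.

HB.instance Definition _ := GRing.Zmodule_isPzRing.Build symalg
  symalg_mulA symalg_mul1l symalg_mul1r symalg_mulDl symalg_mulDr.

Lemma sympureM x y : sympure x * sympure y = sympure (symM x y).
Proof.
apply: symalg_ext => V phi a; rewrite symliftM // exchange_big symlift_pure //.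
under eq_bigr => z _.
  rewrite -symliftMr symlift_pure; last exact: admissibleMr.
  over.
by rewrite -symliftMl symlift_pure //; apply: admissibleMl.
Qed.

Definition symalg_in (c : k) : symalg := sympure (symK X c).

Lemma symalg_in_zmod : zmod_morphism symalg_in.
Proof.
move=> b c; apply/eqP; rewrite eq_sym subr_eq; apply/eqP.
rewrite -[b in LHS](subrK c).
by apply: symalg_ext => V phi a; rewrite symliftD // !symlift_pure // admissibleKD.
Qed.

Lemma symalg_in_monoid : monoid_morphism symalg_in.
Proof.
by split=> [|b c]; rewrite /symalg_in ?symK1 // symKM -sympureM.
Qed.

HB.instance Definition _ :=
  GRing.isZmodMorphism.Build k symalg symalg_in symalg_in_zmod.
HB.instance Definition _ :=
  GRing.isMonoidMorphism.Build k symalg symalg_in symalg_in_monoid.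

Lemma symlift_zmod V (phi : X -> V) : admissible phi ->
  zmod_morphism (symlift phi).
Proof. by move=> a u w; rewrite symliftD // symliftN. Qed.

Lemma symalg_sum (u : symalg) : u = \sum_(x <- repr u) sympure x.
Proof.
apply: symalg_ext => V phi a; rewrite (zmod_morphism_sum _ _ (symlift_zmod a)).
by apply: eq_bigr => x _; rewrite symlift_pure.
Qed.

Lemma symalg_inC c (u : symalg) : symalg_in c * u = u * symalg_in c.
Proof.
rewrite (symalg_sum u) mulr_suml mulr_sumr; apply: eq_bigr => x _.
by rewrite !sympureM symKC.
Qed.

HB.instance Definition _ := isPzAlgebra.Build k symalg symalg_inC.

End SymbolAlgebra.

Section IdealQuotient.
Variables (k : pzRingType) (R : pzAlgType k) (S : R -> Prop).

Definition two_sided_ideal (J : R -> Prop) : Prop :=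
  [/\ J 0, forall x y, J x -> J y -> J (x - y) &
      forall a x, J x -> J (a * x) /\ J (x * a)].

Definition ideal_gen : {pred R} := fun x =>
  `[< forall J, two_sided_ideal J -> (forall y, S y -> J y) -> J x >].

Lemma ideal_gen_zmod : zmod_closed ideal_gen.
Proof.
split=> [|x y /asboolP hx /asboolP hy]; apply/asboolP => J iJ sJ.
  by case: iJ.
by case: (iJ) => _ + _; apply; [exact: hx | exact: hy].
Qed.

HB.instance Definition _ := GRing.isZmodClosed.Build R ideal_gen ideal_gen_zmod.

Lemma ideal_genM a x : x \in ideal_gen ->
  (a * x \in ideal_gen) /\ (x * a \in ideal_gen).
Proof.
move=> /asboolP hx; split; apply/asboolP => J iJ sJ;
by case: (iJ) => _ _ /(_ a x (hx J iJ sJ)) [].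
Qed.

Lemma ideal_gen_sub x : S x -> x \in ideal_gen.
Proof. by move=> sx; apply/asboolP => J _; apply. Qed.

(* The quotient of R by the two-sided ideal generated by S. *)
Definition idealquot := (Quotient.quot ideal_gen).
HB.instance Definition _ := GRing.Zmodule.on idealquot.
HB.instance Definition _ := EqQuotient.on idealquot.

Definition cls (x : R) : idealquot := \pi_idealquot x.

Lemma clsP x y : cls x = cls y <-> x - y \in ideal_gen.
Proof.
rewrite (Quotient.idealrBE ideal_gen); split=> [h|/eqP //].
exact/eqP.
Qed.

Lemma cls_zmod : zmod_morphism cls.
Proof. by move=> x y; rewrite /cls (pi_is_zmod_morphism (Quotient.quot ideal_gen)). Qed.

HB.instance Definition _ := GRing.isZmodMorphism.Build R idealquot cls cls_zmod.

Lemma cls_repr (u : idealquot) : cls (repr u) = u.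
Proof. exact: (reprK u). Qed.

Definition idealquot_one : idealquot := cls 1.
Definition idealquot_mul (u w : idealquot) : idealquot := cls (repr u * repr w).

Lemma idealquot_mulE x y : idealquot_mul (cls x) (cls y) = cls (x * y).
Proof.
apply/clsP.
have /clsP hx := cls_repr (cls x); have /clsP hy := cls_repr (cls y).
rewrite -(subrK (x * repr (cls y)) (_ * _)) -mulrBl -addrA -mulrBr rpredD //.
  by have [] := ideal_genM (repr (cls y)) hx.
by have [] := ideal_genM x hy.
Qed.

Ltac by_cls := repeat (let u := fresh in move=> u; rewrite -(cls_repr u)).

Lemma idealquot_mulA : associative idealquot_mul.
Proof. by by_cls; rewrite !idealquot_mulE mulrA. Qed.
Lemma idealquot_mul1l : left_id idealquot_one idealquot_mul.
Proof. by by_cls; rewrite idealquot_mulE mul1r. Qed.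
Lemma idealquot_mul1r : right_id idealquot_one idealquot_mul.
Proof. by by_cls; rewrite idealquot_mulE mulr1. Qed.
Lemma idealquot_mulDl : left_distributive idealquot_mul +%R.
Proof. by by_cls; rewrite -raddfD !idealquot_mulE mulrDl raddfD. Qed.
Lemma idealquot_mulDr : right_distributive idealquot_mul +%R.
Proof. by by_cls; rewrite -raddfD !idealquot_mulE mulrDr raddfD. Qed.

HB.instance Definition _ := GRing.Zmodule_isPzRing.Build idealquot
  idealquot_mulA idealquot_mul1l idealquot_mul1r idealquot_mulDl idealquot_mulDr.

Lemma cls_monoid : monoid_morphism cls.
Proof. by split=> // x y; rewrite -idealquot_mulE. Qed.

HB.instance Definition _ :=
  GRing.isMonoidMorphism.Build R idealquot cls cls_monoid.

Definition idealquot_in : {rmorphism k -> idealquot} := cls \o in_pzalg.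

Lemma idealquot_inC c (u : idealquot) : idealquot_in c * u = u * idealquot_in c.
Proof. by rewrite -(cls_repr u) /= -!rmorphM in_pzalgC. Qed.

HB.instance Definition _ := isPzAlgebra.Build k idealquot idealquot_inC.

End IdealQuotient.

Record gammaAlg (k : fieldType) (Gam : groupType) := GammaAlg {
  ga_alg :> comPzAlgType k;
  act : Gam -> ga_alg -> ga_alg;
  act_hom : forall g, alg_hom (act g);
  act1 : forall b, act 1%g b = b;
  actM : forall g h b, act (g * h)%g b = act g (act h b)
}.

Arguments act {k Gam _} _ _.
Arguments act_hom {k Gam _} _.

Section BGAlgebras.
Variables (k : fieldType) (Gam : groupType) (B : gammaAlg k Gam).

(* deg_span and deg_indep say that the algebra is the direct sum of the
   subspaces deg g h. *)
Record bgAlg := BGAlg {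
  bg_alg :> pzAlgType k;
  deg : Gam -> Gam -> bg_alg -> Prop;
  bg_r : B -> bg_alg;
  bg_s : B -> bg_alg;
  deg0 : forall g h, deg g h 0;
  degB : forall g h x y, deg g h x -> deg g h y -> deg g h (x - y);
  degK : forall g h c x, deg g h x -> deg g h (in_pzalg c * x);
  degM : forall g h g' h' x y,
    deg g h x -> deg g' h' y -> deg (g * g')%g (h * h')%g (x * y);
  deg_span : forall x, exists2 l : seq (Gam * Gam * bg_alg),
    (forall p, p \in l -> deg p.1.1 p.1.2 p.2) & x = \sum_(p <- l) p.2;
  deg_indep : forall (t : seq (Gam * Gam)) (z : Gam * Gam -> bg_alg),
    uniq t -> (forall d, deg d.1 d.2 (z d)) -> \sum_(d <- t) z d = 0 ->
    forall d, d \in t -> z d = 0;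
  bg_r_hom : alg_hom bg_r;
  bg_s_hom : alg_hom bg_s;
  bg_r_deg : forall b, deg 1%g 1%g (bg_r b);
  bg_s_deg : forall b, deg 1%g 1%g (bg_s b);
  bg_rsC : forall b b', bg_r b * bg_s b' = bg_s b' * bg_r b;
  bg_rE : forall g h x b, deg g h x -> x * bg_r b = bg_r (act g b) * x;
  bg_sE : forall g h x b, deg g h x -> x * bg_s b = bg_s (act h b) * x
}.

Definition bg_hom (A C : bgAlg) (f : A -> C) : Prop :=
  [/\ alg_hom f,
      forall g h x, deg g h x -> deg g h (f x),
      forall b, f (bg_r A b) = bg_r C b &
      forall b, f (bg_s A b) = bg_s C b].

End BGAlgebras.

Arguments deg {k Gam B} _.
Arguments bg_r {k Gam B} _.
Arguments bg_s {k Gam B} _.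

Section CrossedProduct.
Variables (k : fieldType) (Gam : groupType) (B : gammaAlg k Gam).
Implicit Types (x y : B * Gam).

Definition crossM x y : B * Gam := (x.1 * act x.2 y.1, (x.2 * y.2)%g).
Definition crossN x : B * Gam := (- x.1, x.2).
Definition crossK (c : k) : B * Gam := (in_pzalg c, 1%g).
Definition additive_in_coef (V : zmodType) (phi : B * Gam -> V) : Prop :=
  forall g, zmod_morphism (fun b => phi (b, g)).

Lemma crossMA : associative crossM.
Proof.
by case=> [a g] [b h] [c l]; rewrite /crossM /= (alg_homM (act_hom g)) mulrA actM mulgA.
Qed.
Lemma cross1M : left_id (1, 1%g) crossM.
Proof. by case=> [b g]; rewrite /crossM /= mul1r mul1g act1. Qed.
Lemma crossM1 : right_id (1, 1%g) crossM.
Proof. by case=> [b g]; rewrite /crossM /= (alg_hom1 (act_hom g)) mulr1 mulg1. Qed.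
Lemma crossKC c x : crossM (crossK c) x = crossM x (crossK c).
Proof.
by case: x => b g; rewrite /crossM /= act1 (alg_homK (act_hom g)) mul1g mulg1 mulrC.
Qed.
Lemma crossK1 : crossK 1 = (1, 1%g).
Proof. by rewrite /crossK rmorph1. Qed.
Lemma crossKM b c : crossK (b * c) = crossM (crossK b) (crossK c).
Proof. by rewrite /crossK /crossM /= rmorphM act1 mulg1. Qed.
Lemma cross_admN (V : zmodType) (phi : B * Gam -> V) x :
  additive_in_coef phi -> phi (crossN x) = - phi x.
Proof. by case: x => b g /(_ g) /zmod_morphismN /(_ b). Qed.
Lemma cross_admKD (V : zmodType) (phi : B * Gam -> V) b c :
  additive_in_coef phi -> phi (crossK (b + c)) = phi (crossK b) + phi (crossK c).
Proof. by move=> /(_ 1%g) /zmod_morphismD h; rewrite /crossK rmorphD -h. Qed.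
Lemma cross_admMl (V : zmodType) (phi : B * Gam -> V) x :
  additive_in_coef phi -> additive_in_coef (fun y => phi (crossM x y)).
Proof.
by move=> h g b c; rewrite /crossM /= (alg_homB (act_hom _)) mulrBr h.
Qed.
Lemma cross_admMr (V : zmodType) (phi : B * Gam -> V) y :
  additive_in_coef phi -> additive_in_coef (fun x => phi (crossM x y)).
Proof. by move=> h g b c; rewrite /crossM /= mulrBl h. Qed.

Definition cross_symbols : symbols k :=
  Symbols crossMA cross1M crossM1 crossKC crossK1 crossKM
    cross_admN cross_admKD cross_admMl cross_admMr.

Definition cross_alg : pzAlgType k := symalg cross_symbols.

Definition cpure (b : B) (g : Gam) : cross_alg := @sympure k cross_symbols (b, g).

(* The span of B g in degree (g, g), and 0 off the diagonal. *)
Definition cross_deg (g h : Gam) (u : cross_alg) : Prop :=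
  exists2 b, u = cpure b g & (g <> h -> b = 0).
Definition cross_emb (b : B) : cross_alg := cpure b 1%g.

Lemma cpure_zmod g : zmod_morphism (cpure ^~ g).
Proof.
move=> b c; apply: symalg_ext => V phi a.
by rewrite (symlift_zmod a) !symlift_pure //; apply: (a g).
Qed.
Lemma cpureM b g c h : cpure b g * cpure c h = cpure (b * act g c) (g * h)%g.
Proof. exact: sympureM. Qed.
Lemma cpureK c : cpure (in_pzalg c) 1%g = in_pzalg c.
Proof. by []. Qed.

Lemma cross_deg0 g h : cross_deg g h 0.
Proof. by exists 0; rewrite ?(zmod_morphism0 (cpure_zmod g)). Qed.
Lemma cross_degB g h u w :
  cross_deg g h u -> cross_deg g h w -> cross_deg g h (u - w).
Proof.
move=> [b -> hb] [c -> hc]; exists (b - c); first by rewrite cpure_zmod.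
by move=> n; rewrite hb // hc // subrr.
Qed.
Lemma cross_degM g h g' h' u w :
  cross_deg g h u -> cross_deg g' h' w -> cross_deg (g * g')%g (h * h')%g (u * w).
Proof.
move=> [b -> hb] [c -> hc]; exists (b * act g c); first exact: cpureM.
move=> n; have [e|/eqP/hb->] := eqVneq g h; last by rewrite mul0r.
have [e'|/eqP/hc->] := eqVneq g' h'; first by case: n; rewrite e e'.
by rewrite (alg_hom0 (act_hom g)) mulr0.
Qed.
Lemma cross_emb_deg b : cross_deg 1%g 1%g (cross_emb b).
Proof. by exists b. Qed.
Lemma cross_degK g h c u : cross_deg g h u -> cross_deg g h (in_pzalg c * u).
Proof.
move=> /(cross_degM (cross_emb_deg (in_pzalg c))).
by rewrite !mul1g /cross_emb cpureK.
Qed.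

Lemma cross_deg_span u : exists2 l : seq (Gam * Gam * cross_alg),
  (forall p, p \in l -> cross_deg p.1.1 p.1.2 p.2) & u = \sum_(p <- l) p.2.
Proof.
exists [seq (x.2, x.2, cpure x.1 x.2) | x <- (repr u : seq (B * Gam))].
  by move=> _ /mapP[x _ ->] /=; exists x.1.
by rewrite big_map [LHS]symalg_sum; apply: eq_bigr; case.
Qed.

Definition cross_coef (g : Gam) (u : cross_alg) : B :=
  symlift (fun x : cross_symbols => if x.2 == g then x.1 else 0) u.

Lemma cross_coef_adm g :
  additive_in_coef (fun x => if x.2 == g then x.1 else 0 : B).
Proof. by move=> h b c /=; case: eqP => //; rewrite subrr. Qed.

Lemma cross_coefE g b h : cross_coef g (cpure b h) = if h == g then b else 0.
Proof. by rewrite /cross_coef symlift_pure //; apply: cross_coef_adm. Qed.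

Lemma cross_coef_zmod g : zmod_morphism (cross_coef g).
Proof. by apply: symlift_zmod; apply: cross_coef_adm. Qed.

Lemma cross_deg_indep (t : seq (Gam * Gam)) (z : Gam * Gam -> cross_alg) :
  uniq t -> (forall d, cross_deg d.1 d.2 (z d)) -> \sum_(d <- t) z d = 0 ->
  forall d, d \in t -> z d = 0.
Proof.
move=> ut hz sz0 d0 d0t.
have zoff d : d.1 <> d.2 -> z d = 0.
  move=> n; have [b -> /(_ n) ->] := hz d.
  exact: (zmod_morphism0 (cpure_zmod _)).
have [e0|/eqP/zoff //] := eqVneq d0.1 d0.2.
have [b0 zd0 _] := hz d0; move/(congr1 (cross_coef d0.1)): sz0.
rewrite (zmod_morphism_sum _ _ (cross_coef_zmod _)).
rewrite (zmod_morphism0 (cross_coef_zmod _)) (bigD1_seq d0) //= big1.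
  rewrite addr0 zd0 cross_coefE eqxx => ->.
  exact: (zmod_morphism0 (cpure_zmod _)).
move=> d nd; have [e|/eqP/zoff->] := eqVneq d.1 d.2; last first.
  exact: (zmod_morphism0 (cross_coef_zmod _)).
have [b -> _] := hz d; rewrite cross_coefE; case: eqP => // e1.
by case/eqP: nd; case: d d0 e e0 e1 {d0t zd0 zoff} => [? ?] [? ?] /= -> -> ->.
Qed.

Lemma cross_emb_hom : alg_hom cross_emb.
Proof.
split=> [| |c]; first exact: cpure_zmod.
  by split=> // b c; rewrite [RHS]cpureM act1 mulg1.
exact: cpureK.
Qed.

Lemma cross_embC b b' : cross_emb b * cross_emb b' = cross_emb b' * cross_emb b.
Proof. by rewrite /cross_emb !cpureM !act1 mulrC. Qed.

Lemma cross_embE g h u b :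
  cross_deg g h u -> u * cross_emb b = cross_emb (act g b) * u.
Proof.
by move=> [c -> _]; rewrite /cross_emb !cpureM act1 mulg1 mul1g mulrC.
Qed.

Lemma cross_embE' g h u b :
  cross_deg g h u -> u * cross_emb b = cross_emb (act h b) * u.
Proof.
have [->|/eqP n] := eqVneq g h; first exact: cross_embE.
move=> [c -> /(_ n) ->]; rewrite (zmod_morphism0 (cpure_zmod g)).
by rewrite mul0r mulr0.
Qed.

Definition cross : bgAlg B :=
  BGAlg cross_deg0 cross_degB cross_degK cross_degM cross_deg_span
    cross_deg_indep cross_emb_hom cross_emb_hom cross_emb_deg cross_emb_deg
    cross_embC cross_embE cross_embE'.

End CrossedProduct.

Section CoOpposite.
Variables (k : fieldType) (Gam : groupType) (B : gammaAlg k Gam) (A : bgAlg B).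

(* Convertible to A as a type, so that elements of coop A can be multiplied
   in A after a cast. *)
Definition coop_carrier : Type := A^c.
HB.instance Definition _ := GRing.PzRing.on coop_carrier.

Definition coop_in (c : k) : coop_carrier := in_pzalg c : A.
Lemma coop_in_zmod : zmod_morphism coop_in.
Proof. exact: (rmorphB (@in_pzalg k A)). Qed.
Lemma coop_in_monoid : monoid_morphism coop_in.
Proof.
split=> [|b c]; first exact: (rmorph1 (@in_pzalg k A)).
by rewrite mulrC; exact: (rmorphM (@in_pzalg k A)).
Qed.
HB.instance Definition _ :=
  GRing.isZmodMorphism.Build k coop_carrier coop_in coop_in_zmod.
HB.instance Definition _ :=
  GRing.isMonoidMorphism.Build k coop_carrier coop_in coop_in_monoid.
Lemma coop_inC c (x : coop_carrier) : coop_in c * x = x * coop_in c.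
Proof. exact: (esym (in_pzalgC c (x : A))). Qed.
HB.instance Definition _ := isPzAlgebra.Build k coop_carrier coop_inC.

Definition coop_deg (g h : Gam) (x : coop_carrier) : Prop :=
  deg A h^-1%g g^-1%g x.

Lemma coop_deg0 g h : coop_deg g h 0.
Proof. exact: deg0. Qed.
Lemma coop_degB g h x y : coop_deg g h x -> coop_deg g h y -> coop_deg g h (x - y).
Proof. exact: degB. Qed.
Lemma coop_degK g h c x : coop_deg g h x -> coop_deg g h (in_pzalg c * x).
Proof. by move=> hx; rewrite in_pzalgC; exact: degK. Qed.
Lemma coop_degM g h g' h' x y :
  coop_deg g h x -> coop_deg g' h' y -> coop_deg (g * g')%g (h * h')%g (x * y).
Proof. by move=> hx hy; rewrite /coop_deg !invgM; exact: degM. Qed.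
Lemma coop_deg_span x : exists2 l : seq (Gam * Gam * coop_carrier),
  (forall p, p \in l -> coop_deg p.1.1 p.1.2 p.2) & x = \sum_(p <- l) p.2.
Proof.
have [l hl ->] := deg_span x.
exists [seq (p.1.2^-1%g, p.1.1^-1%g, p.2) | p <- l]; last by rewrite big_map.
by move=> _ /mapP[p /hl hp ->]; rewrite /coop_deg /= !invgK.
Qed.
Lemma coop_deg_indep (t : seq (Gam * Gam)) (z : Gam * Gam -> coop_carrier) :
  uniq t -> (forall d, coop_deg d.1 d.2 (z d)) -> \sum_(d <- t) z d = 0 ->
  forall d, d \in t -> z d = 0.
Proof.
pose i (d : Gam * Gam) := (d.2^-1%g, d.1^-1%g).
have iK : involutive i by case=> g h; rewrite /i /= !invgK.
move=> ut hz sz0 d dt; rewrite -[d]iK.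
apply: (@deg_indep _ _ _ A [seq i e | e <- t] (fun e => z (i e))).
- by rewrite map_inj_uniq //; apply: inv_inj.
- by case=> g h; have := hz (i (g, h)); rewrite /coop_deg /= !invgK.
- by rewrite big_map; under eq_bigr do rewrite iK.
- by rewrite map_f.
Qed.
Lemma coop_rC b b' : (bg_s A b : coop_carrier) * (bg_r A b' : coop_carrier) =
  (bg_r A b' : coop_carrier) * (bg_s A b : coop_carrier).
Proof. exact: (@bg_rsC _ _ _ A b' b). Qed.
Lemma coop_r_hom : alg_hom (bg_s A : B -> coop_carrier).
Proof.
have [hB [h1 hM] hK] := bg_s_hom A; split=> //; split=> // b c.
by rewrite [b * c]mulrC hM.
Qed.
Lemma coop_s_hom : alg_hom (bg_r A : B -> coop_carrier).
Proof.
have [hB [h1 hM] hK] := bg_r_hom A; split=> //; split=> // b c.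
by rewrite [b * c]mulrC hM.
Qed.
Lemma coop_r_deg b : coop_deg 1%g 1%g (bg_s A b).
Proof. by rewrite /coop_deg !invg1; exact: bg_s_deg. Qed.
Lemma coop_s_deg b : coop_deg 1%g 1%g (bg_r A b).
Proof. by rewrite /coop_deg !invg1; exact: bg_r_deg. Qed.
Lemma coop_rE g h (x : coop_carrier) b :
  coop_deg g h x -> x * (bg_s A b : coop_carrier) = (bg_s A (act g b) : coop_carrier) * x.
Proof.
move=> /(bg_sE (act g b)); rewrite -actM mulVg act1 => e.
exact: (esym e).
Qed.
Lemma coop_sE g h (x : coop_carrier) b :
  coop_deg g h x -> x * (bg_r A b : coop_carrier) = (bg_r A (act h b) : coop_carrier) * x.
Proof.
move=> /(bg_rE (act h b)); rewrite -actM mulVg act1 => e.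
exact: (esym e).
Qed.

Definition coop : bgAlg B :=
  BGAlg coop_deg0 coop_degB coop_degK coop_degM coop_deg_span coop_deg_indep
    coop_r_hom coop_s_hom coop_r_deg coop_s_deg coop_rC coop_rE coop_sE.

End CoOpposite.

Section TensorProduct.
Variables (k : fieldType) (A C : pzAlgType k).
Implicit Types (x y : A * C).

Definition tensM x y : A * C := (x.1 * y.1, x.2 * y.2).
Definition tensN x : A * C := (- x.1, x.2).
Definition tensK (c : k) : A * C := (in_pzalg c, 1).
Definition balanced_biadditive (V : zmodType) (phi : A * C -> V) : Prop :=
  [/\ forall c, zmod_morphism (fun a => phi (a, c)),
      forall a, zmod_morphism (fun c => phi (a, c)) &
      forall (l : k) a c, phi (in_pzalg l * a, c) = phi (a, in_pzalg l * c)].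

Lemma tensMA : associative tensM.
Proof. by move=> x y z; rewrite /tensM /= !mulrA. Qed.
Lemma tens1M : left_id (1, 1) tensM.
Proof. by case=> a c; rewrite /tensM /= !mul1r. Qed.
Lemma tensM1 : right_id (1, 1) tensM.
Proof. by case=> a c; rewrite /tensM /= !mulr1. Qed.
Lemma tensKC c x : tensM (tensK c) x = tensM x (tensK c).
Proof. by rewrite /tensM /= in_pzalgC mul1r mulr1. Qed.
Lemma tensK1 : tensK 1 = (1, 1).
Proof. by rewrite /tensK rmorph1. Qed.
Lemma tensKM b c : tensK (b * c) = tensM (tensK b) (tensK c).
Proof. by rewrite /tensM /tensK /= rmorphM mulr1. Qed.
Lemma tens_admN (V : zmodType) (phi : A * C -> V) x :
  balanced_biadditive phi -> phi (tensN x) = - phi x.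
Proof. by case: x => a c [/(_ c) /zmod_morphismN h _ _]; exact: h. Qed.
Lemma tens_admKD (V : zmodType) (phi : A * C -> V) b c :
  balanced_biadditive phi -> phi (tensK (b + c)) = phi (tensK b) + phi (tensK c).
Proof. by case=> /(_ 1) /zmod_morphismD h _ _; rewrite /tensK rmorphD -h. Qed.
Lemma tens_admMl (V : zmodType) (phi : A * C -> V) x :
  balanced_biadditive phi -> balanced_biadditive (fun y => phi (tensM x y)).
Proof.
case: x => a c [h1 h2 h3]; split=> [c' a1 a2 | a' c1 c2 | l a' c'];
  rewrite /tensM /=.
- by rewrite mulrBr h1.
- by rewrite mulrBr h2.
- by rewrite !mulrA -!in_pzalgC -!mulrA h3.
Qed.
Lemma tens_admMr (V : zmodType) (phi : A * C -> V) y :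
  balanced_biadditive phi -> balanced_biadditive (fun x => phi (tensM x y)).
Proof.
case: y => a c [h1 h2 h3]; split=> [c' a1 a2 | a' c1 c2 | l a' c'];
  rewrite /tensM /=.
- by rewrite mulrBl h1.
- by rewrite mulrBl h2.
- by rewrite -!mulrA h3.
Qed.

Definition tens_symbols : symbols k :=
  Symbols tensMA tens1M tensM1 tensKC tensK1 tensKM
    tens_admN tens_admKD tens_admMl tens_admMr.

Definition tens : pzAlgType k := symalg tens_symbols.

Definition tpure (a : A) (c : C) : tens := @sympure k tens_symbols (a, c).

Lemma tpureM a c a' c' : tpure a c * tpure a' c' = tpure (a * a') (c * c').
Proof. exact: sympureM. Qed.

Lemma tpure_admissible : balanced_biadditive (fun x => tpure x.1 x.2).
Proof.
split=> [c a1 a2 | a c1 c2 | l a c]; apply: symalg_ext => V phi ad;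
  rewrite ?(symlift_zmod ad) !symlift_pure //; case: ad => h1 h2 h3.
- exact: h1.
- exact: h2.
- exact: h3.
Qed.

End TensorProduct.

Section Components.
Variables (k : fieldType) (Gam : groupType) (B : gammaAlg k Gam) (A : bgAlg B).
Implicit Types (t : seq (Gam * Gam)) (z : Gam * Gam -> A) (x : A).

Definition decomp x t z : Prop :=
  [/\ uniq t, forall d, deg A d.1 d.2 (z d), forall d, d \notin t -> z d = 0 &
      x = \sum_(d <- t) z d].

Lemma degD g h x y : deg A g h x -> deg A g h y -> deg A g h (x + y).
Proof.
move=> hx hy; rewrite -[y]opprK; apply: degB => //.
by rewrite -sub0r; apply: degB => //; exact: deg0.
Qed.

Lemma deg_sum g h I (r : seq I) (P : pred I) (E : I -> A) :
  (forall i, P i -> deg A g h (E i)) -> deg A g h (\sum_(i <- r | P i) E i).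
Proof. by move=> hE; apply: big_ind => //; [exact: deg0 | exact: degD]. Qed.

Lemma decomp_ex x : exists tz, decomp x tz.1 tz.2.
Proof.
have [l hl ->] := deg_span x.
exists (undup [seq p.1 | p <- l], fun d => \sum_(p <- l | p.1 == d) p.2).
split=> /= [|d|d|]; first exact: undup_uniq.
- rewrite big_seq_cond; apply: deg_sum => p /andP[/hl + /eqP<-]; exact.
- rewrite mem_undup => dl; rewrite big_seq_cond big_pred0 // => p.
  apply/andP=> -[pl /eqP e]; case/negP: dl; rewrite -e; exact: map_f.
- rewrite (exchange_big_dep predT) //= [LHS]big_seq [RHS]big_seq.
  apply: eq_bigr => p pl; under eq_bigl do rewrite eq_sym.
  rewrite -big_filter filter_pred1_uniq ?undup_uniq ?big_seq1 //.
  by rewrite mem_undup map_f.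
Qed.

Lemma decomp_widen x t z t' :
  decomp x t z -> uniq t' -> {subset t <= t'} -> x = \sum_(d <- t') z d.
Proof.
move=> [ut _ z0 ->] ut' tt'.
rewrite [RHS](bigID (fun d => d \in t)) /= [X in _ + X]big1 ?addr0; last first.
  by move=> d; exact: z0.
rewrite -[RHS]big_filter; apply: perm_big; apply: uniq_perm => //.
  exact: filter_uniq.
by move=> d; rewrite mem_filter /=; case: (boolP (d \in t)) => // /tt' ->.
Qed.

Lemma decomp_inj x t z t' z' : decomp x t z -> decomp x t' z' -> z =1 z'.
Proof.
move=> D D' d; pose u := undup (t ++ t').
have uu : uniq u by exact: undup_uniq.
have e : \sum_(d <- u) (z d - z' d) = 0.
  rewrite sumrB -(decomp_widen D) ?(decomp_widen D' uu) ?subrr //;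
    by move=> e et; rewrite mem_undup mem_cat et ?orbT.
have [_ hz z0 _] := D; have [_ hz' z0' _] := D'.
have [du|] := boolP (d \in u); last first.
  by rewrite mem_undup mem_cat negb_or => /andP[/z0 -> /z0' ->].
apply/eqP; rewrite -subr_eq0; apply/eqP.
apply: (deg_indep uu (z := fun d => z d - z' d)) => // d'; exact: degB.
Qed.

Definition compsupp x := (projT1 (cid (decomp_ex x))).1.
Definition comp x := (projT1 (cid (decomp_ex x))).2.

Lemma compP x : decomp x (compsupp x) (comp x).
Proof. exact: (projT2 (cid (decomp_ex x))). Qed.

Lemma comp_deg x d : deg A d.1 d.2 (comp x d).
Proof. by case: (compP x). Qed.

Lemma comp_eq x t z : decomp x t z -> comp x =1 z.
Proof. exact: decomp_inj (compP x). Qed.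

Lemma compB x y d : comp (x - y) d = comp x d - comp y d.
Proof.
have Dx := compP x; have Dy := compP y.
pose u := undup (compsupp x ++ compsupp y).
have uu : uniq u by exact: undup_uniq.
apply: (@comp_eq _ u (fun d => comp x d - comp y d)); split=> // [e|e|].
- by apply: degB; exact: comp_deg.
- rewrite mem_undup mem_cat negb_or => /andP[ex ey].
  by have [_ _ -> // _] := Dx; have [_ _ -> // _] := Dy; rewrite subr0.
- by rewrite sumrB -(decomp_widen Dx) -?(decomp_widen Dy uu) //;
    move=> e et; rewrite mem_undup mem_cat et ?orbT.
Qed.

Lemma comp_hom g h x d :
  deg A g h x -> comp x d = if d == (g, h) then x else 0.
Proof.
move=> hx; apply: (@comp_eq _ [:: (g, h)] (fun d => if d == (g, h) then x else 0)).
split=> // [e|e|]; last by rewrite big_seq1 eqxx.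
- by case: eqP => [->|_] //; exact: deg0.
- by rewrite inE => /negPf ->.
Qed.

Lemma compK c x d : comp (in_pzalg c * x) d = in_pzalg c * comp x d.
Proof.
have [ux hx x0 ex] := compP x.
apply: (@comp_eq _ (compsupp x) (fun d => in_pzalg c * comp x d)); split=> //.
- by move=> e; exact: degK.
- by move=> e /x0 ->; rewrite mulr0.
- by rewrite {1}ex mulr_sumr.
Qed.

Section GradedSum.
Variables (V : zmodType) (F : Gam * Gam -> A -> V).
Hypothesis F_add : forall d x y, deg A d.1 d.2 x -> deg A d.1 d.2 y ->
  F d (x - y) = F d x - F d y.

Definition gsum x : V := \sum_(d <- compsupp x) F d (comp x d).

Lemma gsumF0 d : F d 0 = 0.
Proof.
by rewrite -(subrr (0 : A)) F_add ?subrr //; exact: deg0.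
Qed.

Lemma gsum_widen x t : uniq t -> {subset compsupp x <= t} ->
  gsum x = \sum_(d <- t) F d (comp x d).
Proof.
move=> ut xt; have [ux _ x0 _] := compP x.
rewrite [RHS](bigID (fun d => d \in compsupp x)) /= [X in _ + X]big1 ?addr0; last first.
  by move=> d /x0 ->; exact: gsumF0.
rewrite -[RHS]big_filter; apply: perm_big; apply: uniq_perm => //.
  exact: filter_uniq.
by move=> d; rewrite mem_filter /=; case: (boolP (d \in compsupp x)) => // /xt ->.
Qed.

Lemma gsumB x y : gsum (x - y) = gsum x - gsum y.
Proof.
pose u := undup (compsupp (x - y) ++ compsupp x ++ compsupp y).
have uu : uniq u by exact: undup_uniq.
rewrite !(@gsum_widen _ u) //; try by
  move=> e et; rewrite mem_undup !mem_cat et ?orbT.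
rewrite -sumrB; apply: eq_bigr => d _; rewrite compB F_add //; exact: comp_deg.
Qed.

Lemma gsum_hom g h x : deg A g h x -> gsum x = F (g, h) x.
Proof.
move=> hx; pose u := undup ((g, h) :: compsupp x).
have uu : uniq u by exact: undup_uniq.
rewrite (@gsum_widen _ u) //; last first.
  by move=> e et; rewrite mem_undup inE et orbT.
rewrite (bigD1_seq (g, h)) ?mem_undup ?mem_head //= (comp_hom _ hx) eqxx.
rewrite big1 ?addr0 // => d /negPf nd; rewrite (comp_hom _ hx) nd; exact: gsumF0.
Qed.
End GradedSum.

End Components.

Lemma deg_one (k : fieldType) (Gam : groupType) (B : gammaAlg k Gam)
  (D : bgAlg B) : deg D 1%g 1%g 1.
Proof. by rewrite -(alg_hom1 (bg_r_hom D)); exact: bg_r_deg. Qed.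

Section FiberProduct.
Variables (k : fieldType) (Gam : groupType) (B : gammaAlg k Gam) (A C : bgAlg B).
Implicit Types (a : A) (c : C) (x : A * C).

Definition matching x : Prop :=
  exists g g' h, deg A g g' x.1 /\ deg C g' h x.2.

(* The sum of the A_(g, g') (x) C_(g', h) inside the tensor product over k. *)
Definition gam_tens : {pred tens A C} := fun u =>
  `[< exists2 l : seq (A * C), (forall x, x \in l -> matching x) &
      u = \sum_(x <- l) tpure x.1 x.2 >].

Lemma gam_tens_pure a c g g' h :
  deg A g g' a -> deg C g' h c -> tpure a c \in gam_tens.
Proof.
move=> ha hc; apply/asboolP; exists [:: (a, c)]; last by rewrite big_seq1.
by move=> x; rewrite inE => /eqP ->; exists g, g', h.
Qed.

Lemma gam_tens1 : 1 \in gam_tens.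
Proof.
apply: (@gam_tens_pure 1 1 1%g 1%g 1%g).
  by rewrite -(alg_hom1 (bg_r_hom A)); exact: bg_r_deg.
by rewrite -(alg_hom1 (bg_r_hom C)); exact: bg_r_deg.
Qed.

Lemma gam_tens_subring : subring_closed gam_tens.
Proof.
have [t1 t2 t3] := tpure_admissible A C.
split=> [|u w /asboolP[l hl ->] /asboolP[m hm ->]|u w /asboolP[l hl ->] /asboolP[m hm ->]].
- exact: gam_tens1.
- apply/asboolP; exists (l ++ [seq (- x.1, x.2) | x <- m]).
    move=> x; rewrite mem_cat => /orP[/hl //|/mapP[y /hm [g [g' [h [h1 h2]]]] ->]].
    by exists g, g', h; split=> //=; rewrite -sub0r; apply: degB => //; exact: deg0.
  rewrite big_cat big_map -sumrN /=; congr (_ + _); apply: eq_bigr => x _.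
  by rewrite -(zmod_morphismN (t1 x.2)).
- apply/asboolP; exists [seq tensM x y | x <- l, y <- m].
    move=> _ /allpairsP[[x y] /= [/hl [g [g' [h [h1 h2]]]] /hm [i [i' [j [h3 h4]]]] ->]].
    by exists (g * i)%g, (g' * i')%g, (h * j)%g; split; exact: degM.
  rewrite big_allpairs_dep mulr_suml; apply: eq_bigr => x _.
  by rewrite mulr_sumr; apply: eq_bigr => y _; rewrite tpureM.
Qed.

Record gam_tens_type :=
  GamTens { gam_tens_val : tens A C; _ : gam_tens_val \in gam_tens }.
HB.instance Definition _ := [isSub for gam_tens_val].
HB.instance Definition _ := [Choice of gam_tens_type by <:].
HB.instance Definition _ := GRing.SubChoice_isSubPzRing.Build
  (tens A C) gam_tens gam_tens_type gam_tens_subring.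

Lemma gam_tens_val_zmod : zmod_morphism gam_tens_val.
Proof. exact: (rmorphB (val : gam_tens_type -> tens A C)). Qed.

Lemma gam_tens_in_subproof (d : k) : in_pzalg d \in gam_tens.
Proof.
apply: (@gam_tens_pure (in_pzalg d) 1 1%g 1%g 1%g).
  by rewrite -(alg_homK (bg_r_hom A)); exact: bg_r_deg.
by rewrite -(alg_hom1 (bg_r_hom C)); exact: bg_r_deg.
Qed.
Definition gam_tens_in (d : k) : gam_tens_type := GamTens (gam_tens_in_subproof d).
Lemma gam_tens_in_zmod : zmod_morphism gam_tens_in.
Proof. by move=> d e; apply: val_inj; rewrite /= rmorphB. Qed.
Lemma gam_tens_in_monoid : monoid_morphism gam_tens_in.
Proof. by split=> [|d e]; apply: val_inj; rewrite /= ?rmorph1 ?rmorphM. Qed.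
HB.instance Definition _ :=
  GRing.isZmodMorphism.Build k gam_tens_type gam_tens_in gam_tens_in_zmod.
HB.instance Definition _ :=
  GRing.isMonoidMorphism.Build k gam_tens_type gam_tens_in gam_tens_in_monoid.
Lemma gam_tens_inC d (u : gam_tens_type) : gam_tens_in d * u = u * gam_tens_in d.
Proof. by apply: val_inj; rewrite /= in_pzalgC. Qed.
HB.instance Definition _ := isPzAlgebra.Build k gam_tens_type gam_tens_inC.

Definition fiber_rel (u : gam_tens_type) : Prop :=
  exists b : B, val u = tpure (bg_s A b) 1 - tpure 1 (bg_r C b).

Definition fiber_alg : pzAlgType k := @idealquot k gam_tens_type fiber_rel.

(* The class of a (x) c; the default 0 of insubd is irrelevant when a and c
   have degrees (g, g') and (g', h). *)
Definition fpure a c : fiber_alg := cls fiber_rel (insubd 0 (tpure a c)).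

Lemma fpureE a c g g' h (ha : deg A g g' a) (hc : deg C g' h c) :
  fpure a c = cls fiber_rel (GamTens (gam_tens_pure ha hc)).
Proof.
congr (cls _ _); apply: val_inj => /=.
by rewrite insubdK //; exact: gam_tens_pure ha hc.
Qed.

Lemma fpureM a c g g' h a' c' i i' j :
  deg A g g' a -> deg C g' h c -> deg A i i' a' -> deg C i' j c' ->
  fpure a c * fpure a' c' = fpure (a * a') (c * c').
Proof.
move=> ha hc ha' hc'.
rewrite (fpureE ha hc) (fpureE ha' hc') (fpureE (degM ha ha') (degM hc hc')).
rewrite -[LHS](rmorphM (cls fiber_rel)); congr (cls _ _).
by apply: val_inj; rewrite /= tpureM.
Qed.

Lemma fpureBl g g' h a a' c :
  deg A g g' a -> deg A g g' a' -> deg C g' h c ->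
  fpure (a - a') c = fpure a c - fpure a' c.
Proof.
move=> ha ha' hc; rewrite (fpureE ha hc) (fpureE ha' hc) (fpureE (degB ha ha') hc).
rewrite -[RHS](raddfB (cls fiber_rel)); congr (cls _ _); apply: val_inj => /=.
by have [t1 _ _] := tpure_admissible A C; exact: t1.
Qed.

Lemma fpureBr g g' h a c c' :
  deg A g g' a -> deg C g' h c -> deg C g' h c' ->
  fpure a (c - c') = fpure a c - fpure a c'.
Proof.
move=> ha hc hc'; rewrite (fpureE ha hc) (fpureE ha hc') (fpureE ha (degB hc hc')).
rewrite -[RHS](raddfB (cls fiber_rel)); congr (cls _ _); apply: val_inj => /=.
by have [_ t2 _] := tpure_admissible A C; exact: t2.
Qed.

Lemma fpureK g g' h (d : k) a c : deg A g g' a -> deg C g' h c ->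
  fpure (in_pzalg d * a) c = fpure a (in_pzalg d * c).
Proof.
move=> ha hc; rewrite (fpureE (degK d ha) hc) (fpureE ha (degK d hc)).
congr (cls _ _); apply: val_inj => /=.
by have [_ _ t3] := tpure_admissible A C; exact: t3.
Qed.

Lemma fpure_rel b : fpure (bg_s A b) 1 = fpure 1 (bg_r C b).
Proof.
rewrite (fpureE (bg_s_deg A b) (deg_one C)) (fpureE (deg_one A) (bg_r_deg C b)).
by apply/clsP; apply: ideal_gen_sub; exists b.
Qed.

Lemma fpure_bal g g' h b a c : deg A g g' a -> deg C g' h c ->
  fpure (bg_s A b * a) c = fpure a (bg_r C b * c).
Proof.
move=> ha hc; rewrite -[c in LHS]mul1r -[a in RHS]mul1r.
rewrite -(fpureM (bg_s_deg A b) (deg_one C) ha hc) fpure_rel.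
by rewrite (fpureM (deg_one A) (bg_r_deg C b) ha hc).
Qed.

Lemma fpure_gen (u : fiber_alg) : exists2 l : seq (A * C),
  (forall x, x \in l -> matching x) & u = \sum_(x <- l) fpure x.1 x.2.
Proof.
rewrite -(cls_repr u); case: (repr u) => w hw.
have /asboolP[l hl e] := hw; exists l => //.
transitivity (\sum_(x <- l) cls fiber_rel (insubd 0 (tpure x.1 x.2))); last by [].
rewrite -[RHS](raddf_sum (cls fiber_rel)); congr (cls _ _); apply: val_inj => /=.
rewrite e (zmod_morphism_sum _ _ gam_tens_val_zmod) /= big_seq [RHS]big_seq; apply: eq_bigr => x /hl[g [g' [h [h1 h2]]]].
by rewrite insubdK //; exact: gam_tens_pure h1 h2.
Qed.

Section Lift.
Variables (V : zmodType) (phi : Gam -> Gam -> Gam -> A -> C -> V).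
Hypothesis phiBl : forall g g' h a a' c,
  deg A g g' a -> deg A g g' a' -> deg C g' h c ->
  phi g g' h (a - a') c = phi g g' h a c - phi g g' h a' c.
Hypothesis phiBr : forall g g' h a c c',
  deg A g g' a -> deg C g' h c -> deg C g' h c' ->
  phi g g' h a (c - c') = phi g g' h a c - phi g g' h a c'.
Hypothesis phi_bal : forall g g' h b a c,
  deg A g g' a -> deg C g' h c ->
  phi g g' h (bg_s A b * a) c = phi g g' h a (bg_r C b * c).

Let phi_in (d : Gam * Gam) a (e : Gam * Gam) c : V :=
  if d.2 == e.1 then phi d.1 d.2 e.2 a c else 0.
Let psi x : V :=
  gsum (fun d a => gsum (fun e c => phi_in d a e c) x.2) x.1.

Let phi_inBr d a : deg A d.1 d.2 a -> forall e c c',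
  deg C e.1 e.2 c -> deg C e.1 e.2 c' ->
  phi_in d a e (c - c') = phi_in d a e c - phi_in d a e c'.
Proof.
move=> ha e c c' hc hc'; rewrite /phi_in; case: eqP => [de|_]; last by rewrite subrr.
by apply: phiBr; rewrite ?de // -?de.
Qed.

Let phi_inBl c d a a' : deg A d.1 d.2 a -> deg A d.1 d.2 a' ->
  gsum (fun e c => phi_in d (a - a') e c) c =
  gsum (fun e c => phi_in d a e c) c - gsum (fun e c => phi_in d a' e c) c.
Proof.
move=> ha ha'; rewrite /gsum -sumrB; apply: eq_bigr => e _.
rewrite /phi_in; case: eqP => [de|_]; last by rewrite subrr.
by apply: phiBl => //; rewrite de; exact: comp_deg.
Qed.

Let psi_adm : balanced_biadditive psi.
Proof.
split=> [c a a' | a c c' | l a c]; rewrite /psi /=.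
- by apply: gsumB => d x y; exact: phi_inBl.
- rewrite /gsum -sumrB; apply: eq_bigr => d _.
  by apply: (gsumB (phi_inBr (comp_deg _ d))).
- rewrite /gsum.
  have e d : \sum_(e <- compsupp c) phi_in d (comp (in_pzalg l * a) d) e (comp c e) =
     \sum_(e <- compsupp (in_pzalg l * c)) phi_in d (comp a d) e
         (comp (in_pzalg l * c) e).
    rewrite -[RHS]/(gsum (fun e => phi_in d (comp a d) e) (in_pzalg l * c)).
    pose u := undup (compsupp (in_pzalg l * c) ++ compsupp c).
    have uu : uniq u by exact: undup_uniq.
    rewrite (gsum_widen (phi_inBr (comp_deg a d)) uu); last first.
      by move=> e et; rewrite mem_undup mem_cat et.
    rewrite -[LHS]/(gsum (fun e => phi_in d (comp (in_pzalg l * a) d) e) c).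
    rewrite (gsum_widen (phi_inBr (comp_deg _ d)) uu); last first.
      by move=> e et; rewrite mem_undup mem_cat et orbT.
    apply: eq_bigr => e _; rewrite !compK /phi_in; case: eqP => // de.
    rewrite -(alg_homK (bg_s_hom A)) phi_bal ?(alg_homK (bg_r_hom C)) //.
      exact: comp_deg.
    by rewrite de; exact: comp_deg.
  have phi0 d : gsum (fun e => phi_in d 0 e) (in_pzalg l * c) = 0.
    by have := @phi_inBl (in_pzalg l * c) d 0 0 (deg0 _ _ _) (deg0 _ _ _);
      rewrite !subrr.
  pose u := undup (compsupp (in_pzalg l * a) ++ compsupp a).
  have uu : uniq u by exact: undup_uniq.
  pose G d a' := gsum (fun e => phi_in d a' e) (in_pzalg l * c).
  pose G' d a' := gsum (fun e => phi_in d a' e) c.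
  rewrite -[RHS]/(gsum G a) -[LHS]/(gsum G' (in_pzalg l * a)).
  rewrite (@gsum_widen _ _ _ _ _ G _ a u) //; first last.
  + by move=> d et; rewrite mem_undup mem_cat et orbT.
  + by move=> d x y; exact: phi_inBl.
  rewrite (@gsum_widen _ _ _ _ _ G' _ _ u) //; first last.
  + by move=> d et; rewrite mem_undup mem_cat et.
  + by move=> d x y; exact: phi_inBl.
  by apply: eq_bigr => d _; exact: e.
Qed.

Let psi_hom g g' h a c : deg A g g' a -> deg C g' h c ->
  psi (a, c) = phi g g' h a c.
Proof.
move=> ha hc; rewrite /psi (gsum_hom _ ha) /=; last first.
  by move=> d x y; exact: phi_inBl.
rewrite (gsum_hom (@phi_inBr (g, g') a ha) hc).
by rewrite /phi_in /= eqxx.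
Qed.

Let Psi (u : gam_tens_type) : V :=
  symlift (psi : tens_symbols A C -> V) (val u : tens A C).

Let PsiB : zmod_morphism Psi.
Proof. move=> u w; rewrite /Psi /=. have h := symlift_zmod (psi_adm : @admissible k (tens_symbols A C) V psi). by rewrite h. Qed.

Let Psi_pure a c g g' h (ha : deg A g g' a) (hc : deg C g' h c) :
  Psi (GamTens (gam_tens_pure ha hc)) = phi g g' h a c.
Proof.
by rewrite /Psi /= symlift_pure ?(psi_hom ha hc) //; exact: psi_adm.
Qed.

Lemma gam_tens_ind (P : gam_tens_type -> Prop) :
  P 0 -> (forall u w, P u -> P w -> P (u + w)) ->
  (forall a c g g' h (ha : deg A g g' a) (hc : deg C g' h c),
     P (GamTens (gam_tens_pure ha hc))) -> forall u, P u.
Proof.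
move=> P0 PD Pp [w hw]; have /asboolP[l hl e] := hw.
have {hw} -> : GamTens hw = \sum_(x <- l) insubd 0 (tpure x.1 x.2).
  apply: val_inj; rewrite /= e (zmod_morphism_sum _ _ gam_tens_val_zmod) big_seq [RHS]big_seq.
  apply: eq_bigr => x /hl[g [g' [h [h1 h2]]]].
  by rewrite /= insubdK //; exact: gam_tens_pure h1 h2.
rewrite big_seq; apply: big_ind => // x /hl[g [g' [h [h1 h2]]]].
have -> : insubd 0 (tpure x.1 x.2) = GamTens (gam_tens_pure h1 h2).
  by apply: val_inj; rewrite /= insubdK //; exact: gam_tens_pure h1 h2.
exact: Pp.
Qed.

Let Psi_rel (u : gam_tens_type) : u \in ideal_gen fiber_rel -> Psi u = 0.
Proof.
move=> /asboolP h.
suff /(_ 1 1) : forall p q, Psi (p * u * q) = 0 by rewrite mul1r mulr1.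
apply: (h (fun u => forall p q, Psi (p * u * q) = 0)); first split.
- by move=> p q; rewrite mulr0 mul0r (zmod_morphism0 PsiB).
- move=> x y hx hy p q.
  by rewrite mulrBr mulrBl PsiB hx hy subrr.
- by move=> a x hx; split=> p q; [rewrite (mulrA p) hx | rewrite -!mulrA (mulrA p) hx].
move=> y [b eb] p q.
elim/gam_tens_ind: p => [|p p' hp hp'|a c g g' h1 ha hc].
- by rewrite !mul0r (zmod_morphism0 PsiB).
- by rewrite !mulrDl (zmod_morphismD PsiB) hp hp' addr0.
elim/gam_tens_ind: q => [|p p' hp hp'|a' c' i i' j ha' hc'].
- by rewrite !mulr0 (zmod_morphism0 PsiB).
- by rewrite !mulrDr (zmod_morphismD PsiB) hp hp' addr0.
have h2 := degM (degM ha (bg_s_deg A b)) ha'.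
have h3 := degM (degM hc (deg_one C)) hc'.
have h4 := degM (degM ha (deg_one A)) ha'.
have h5 := degM (degM hc (bg_r_deg C b)) hc'.
have -> : GamTens (gam_tens_pure ha hc) * y * GamTens (gam_tens_pure ha' hc') =
   GamTens (gam_tens_pure h2 h3) - GamTens (gam_tens_pure h4 h5).
  apply: val_inj; rewrite /= -[gam_tens_val y]/(val y) eb.
  by rewrite mulrBr mulrBl !tpureM.
rewrite PsiB !Psi_pure; apply/eqP; rewrite subr_eq0; apply/eqP.
rewrite !mulr1 (bg_sE b ha) (bg_rE b hc) -!mulrA !mulg1.
by apply: phi_bal; exact: degM.
Qed.

Lemma fiber_lift_ex : exists2 Phi : fiber_alg -> V, zmod_morphism Phi &
  forall g g' h a c, deg A g g' a -> deg C g' h c ->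
    Phi (fpure a c) = phi g g' h a c.
Proof.
have PsiE u w : cls fiber_rel u = cls fiber_rel w -> Psi u = Psi w.
  by move=> /clsP/Psi_rel; rewrite PsiB => /eqP; rewrite subr_eq0 => /eqP.
exists (fun u => Psi (repr u)) => [u w|g g' h a c ha hc].
  rewrite -PsiB; apply: PsiE; rewrite [RHS](raddfB (cls fiber_rel)).
  rewrite (cls_repr (u - w : idealquot fiber_rel)).
  by congr (_ - _); symmetry; exact: cls_repr.
rewrite -(Psi_pure ha hc); apply: PsiE.
by rewrite (fpureE ha hc); exact: cls_repr.
Qed.

End Lift.

Definition fiber_deg (g h : Gam) (u : fiber_alg) : Prop :=
  exists2 l : seq (A * C),
    (forall x, x \in l -> exists g', deg A g g' x.1 /\ deg C g' h x.2) &
    u = \sum_(x <- l) fpure x.1 x.2.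
Definition fiber_r (b : B) : fiber_alg := fpure (bg_r A b) 1.
Definition fiber_s (b : B) : fiber_alg := fpure 1 (bg_s C b).

Lemma fiber_deg0 g h : fiber_deg g h 0.
Proof. by exists [::] => //; rewrite big_nil. Qed.
Lemma fiber_degB g h u w :
  fiber_deg g h u -> fiber_deg g h w -> fiber_deg g h (u - w).
Proof.
move=> [l hl ->] [m hm ->]; exists (l ++ [seq (- x.1, x.2) | x <- m]).
  move=> x; rewrite mem_cat => /orP[/hl //|/mapP[y /hm [g' [h1 h2]] ->]].
  by exists g'; split=> //=; rewrite -sub0r; apply: degB => //; exact: deg0.
rewrite big_cat big_map -sumrN /=; congr (_ + _).
rewrite big_seq [RHS]big_seq; apply: eq_bigr => x /hm [g' [h1 h2]].
have e0 : fpure 0 x.2 = 0.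
  by rewrite -(subrr x.1) (fpureBl h1 h1 h2) subrr.
by have := fpureBl (deg0 A g g') h1 h2; rewrite e0 !sub0r => <-.
Qed.
Lemma fiber_degM g h i j u w :
  fiber_deg g h u -> fiber_deg i j w -> fiber_deg (g * i)%g (h * j)%g (u * w).
Proof.
move=> [l hl ->] [m hm ->]; exists [seq tensM x y | x <- l, y <- m].
  move=> _ /allpairsP[[x y] /= [/hl [g' [h1 h2]] /hm [i' [h3 h4]] ->]].
  by exists (g' * i')%g; split; exact: degM.
rewrite big_allpairs_dep mulr_suml big_seq [RHS]big_seq.
apply: eq_bigr => x /hl[g' [h1 h2]].
rewrite mulr_sumr big_seq [RHS]big_seq; apply: eq_bigr => y /hm[i' [h3 h4]].
exact: fpureM h1 h2 h3 h4.
Qed.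
Lemma fiber_deg_pure g g' h a c :
  deg A g g' a -> deg C g' h c -> fiber_deg g h (fpure a c).
Proof.
move=> ha hc; exists [:: (a, c)]; last by rewrite big_seq1.
by move=> x; rewrite inE => /eqP ->; exists g'.
Qed.
Lemma fiber_r_deg b : fiber_deg 1%g 1%g (fiber_r b).
Proof. by apply: fiber_deg_pure; [exact: bg_r_deg | exact: deg_one]. Qed.
Lemma fiber_s_deg b : fiber_deg 1%g 1%g (fiber_s b).
Proof. by apply: fiber_deg_pure; [exact: deg_one | exact: bg_s_deg]. Qed.
Lemma fpure_in d : fpure (in_pzalg d) 1 = in_pzalg d.
Proof.
congr (cls _ _); apply: val_inj; rewrite /= insubdK //.
exact: gam_tens_in_subproof.
Qed.
Lemma fpure_in' d : fpure 1 (in_pzalg d) = in_pzalg d.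
Proof.
rewrite -fpure_in -[in_pzalg d in LHS]mulr1 -[in_pzalg d in RHS]mulr1.
by rewrite (fpureK d (deg_one A) (deg_one C)).
Qed.
Lemma fpure1 : fpure 1 1 = 1.
Proof. by rewrite -{1}(rmorph1 (@in_pzalg k A)) fpure_in rmorph1. Qed.
Lemma fiber_degK g h d u : fiber_deg g h u -> fiber_deg g h (in_pzalg d * u).
Proof.
move=> hu; rewrite -fpure_in -[g]mul1g -[h]mul1g; apply: fiber_degM => //.
by rewrite -(alg_homK (bg_r_hom A)); exact: fiber_r_deg.
Qed.
Lemma fiber_r_hom : alg_hom fiber_r.
Proof.
split=> [b b'| |d].
- rewrite /fiber_r (alg_homB (bg_r_hom A)).
  exact: fpureBl (bg_r_deg A b) (bg_r_deg A b') (deg_one C).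
- split=> [|b b']; rewrite /fiber_r ?(alg_hom1 (bg_r_hom A)) ?fpure1 //.
  rewrite (alg_homM (bg_r_hom A)) (fpureM (bg_r_deg A b) (deg_one C)
    (bg_r_deg A b') (deg_one C)).
  by rewrite mulr1.
- by rewrite /fiber_r (alg_homK (bg_r_hom A)) fpure_in.
Qed.
Lemma fiber_s_hom : alg_hom fiber_s.
Proof.
split=> [b b'| |d].
- rewrite /fiber_s (alg_homB (bg_s_hom C)).
  exact: fpureBr (deg_one A) (bg_s_deg C b) (bg_s_deg C b').
- split=> [|b b']; rewrite /fiber_s ?(alg_hom1 (bg_s_hom C)) ?fpure1 //.
  rewrite (alg_homM (bg_s_hom C)) (fpureM (deg_one A) (bg_s_deg C b)
    (deg_one A) (bg_s_deg C b')).
  by rewrite mulr1.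
- by rewrite /fiber_s (alg_homK (bg_s_hom C)) fpure_in'.
Qed.
Lemma fiber_rsC b b' : fiber_r b * fiber_s b' = fiber_s b' * fiber_r b.
Proof.
rewrite (fpureM (bg_r_deg A b) (deg_one C) (deg_one A) (bg_s_deg C b')).
rewrite (fpureM (deg_one A) (bg_s_deg C b') (bg_r_deg A b) (deg_one C)).
by rewrite !mulr1 !mul1r.
Qed.
Lemma fiber_rE g h u b : fiber_deg g h u -> u * fiber_r b = fiber_r (act g b) * u.
Proof.
move=> [l hl ->]; rewrite mulr_suml mulr_sumr big_seq [RHS]big_seq.
apply: eq_bigr => x /hl[g' [h1 h2]].
rewrite (fpureM h1 h2 (bg_r_deg A b) (deg_one C)).
rewrite (fpureM (bg_r_deg A _) (deg_one C) h1 h2).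
by rewrite mulr1 mul1r (bg_rE b h1).
Qed.
Lemma fiber_sE g h u b : fiber_deg g h u -> u * fiber_s b = fiber_s (act h b) * u.
Proof.
move=> [l hl ->]; rewrite mulr_suml mulr_sumr big_seq [RHS]big_seq.
apply: eq_bigr => x /hl[g' [h1 h2]].
rewrite (fpureM h1 h2 (deg_one A) (bg_s_deg C b)).
rewrite (fpureM (deg_one A) (bg_s_deg C _) h1 h2).
by rewrite mulr1 mul1r (bg_sE b h2).
Qed.
Lemma fiber_deg_span u : exists2 l : seq (Gam * Gam * fiber_alg),
  (forall p, p \in l -> fiber_deg p.1.1 p.1.2 p.2) & u = \sum_(p <- l) p.2.
Proof.
have [l + ->] := fpure_gen u; elim: l => [|x l IH] hl.
  by exists [::] => //; rewrite !big_nil.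
have [|m hm em] := IH; first by move=> y yl; apply: hl; rewrite inE yl orbT.
have [g [g' [h [h1 h2]]]] := hl x (mem_head _ _).
exists ((g, h, fpure x.1 x.2) :: m); last by rewrite !big_cons em.
move=> p; rewrite inE => /orP[/eqP ->|/hm //] /=.
exact: fiber_deg_pure h1 h2.
Qed.
Lemma fiber_deg_indep (t : seq (Gam * Gam)) (z : Gam * Gam -> fiber_alg) :
  uniq t -> (forall d, fiber_deg d.1 d.2 (z d)) -> \sum_(d <- t) z d = 0 ->
  forall d, d \in t -> z d = 0.
Proof.
move=> ut hz sz0 d0 d0t.
have [||| Phi PhiB PhiE] := @fiber_lift_ex fiber_alg
  (fun g g' h a c => if (g, h) == d0 then fpure a c else 0).
- move=> g g' h a a' c h1 h2 h3; case: eqP => _; last by rewrite subrr.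
  exact: fpureBl h1 h2 h3.
- move=> g g' h a c c' h1 h2 h3; case: eqP => _; last by rewrite subrr.
  exact: fpureBr h1 h2 h3.
- move=> g g' h b a c h1 h2; case: eqP => _ //.
  exact: fpure_bal h1 h2.
have Phiz d : Phi (z d) = if d == d0 then z d else 0.
  have [l hl ->] := hz d; rewrite (zmod_morphism_sum _ _ PhiB).
  transitivity (\sum_(x <- l) if d == d0 then fpure x.1 x.2 else 0).
    rewrite big_seq [RHS]big_seq; apply: eq_bigr => x /hl[g' [h1 h2]].
    by rewrite (PhiE _ _ _ _ _ h1 h2) -surjective_pairing.
  by case: eqP => // _; rewrite big1.
move/(congr1 Phi): sz0; rewrite (zmod_morphism_sum _ _ PhiB) (zmod_morphism0 PhiB).
rewrite (bigD1_seq d0) //= Phiz eqxx big1 ?addr0 // => d /negPf nd.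
by rewrite Phiz nd.
Qed.

Definition fiber : bgAlg B :=
  BGAlg fiber_deg0 fiber_degB fiber_degK fiber_degM fiber_deg_span
    fiber_deg_indep fiber_r_hom fiber_s_hom fiber_r_deg fiber_s_deg
    fiber_rsC fiber_rE fiber_sE.

End FiberProduct.

Section FiberMaps.
Variables (k : fieldType) (Gam : groupType) (B : gammaAlg k Gam).

(* Finitely many homogeneous a_i, c_i of degrees (g, g') and (g', h) such that
   u is the sum of the classes of the a_i (x) c_i. *)
Definition sweedler (A C : bgAlg B) (u : fiber A C) : seq (A * C) :=
  s2val (cid2 (fpure_gen u)).

Lemma sweedler_matching (A C : bgAlg B) (u : fiber A C) x :
  x \in sweedler u -> matching x.
Proof. exact: (s2valP (cid2 (fpure_gen u))). Qed.

Lemma sweedlerE (A C : bgAlg B) (u : fiber A C) :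
  u = \sum_(x <- sweedler u) fpure x.1 x.2.
Proof. exact: (s2valP' (cid2 (fpure_gen u))). Qed.

(* Independent of the chosen decomposition when phi is biadditive on
   homogeneous elements and phi (s b * a) c = phi a (r b * c), see fliftE. *)
Definition flift (A C : bgAlg B) (V : zmodType) (phi : A -> C -> V)
  (u : fiber A C) : V := \sum_(x <- sweedler u) phi x.1 x.2.

Lemma fliftE (A C : bgAlg B) (V : zmodType) (phi : A -> C -> V) :
  (forall g g' h a a' c, deg A g g' a -> deg A g g' a' -> deg C g' h c ->
     phi (a - a') c = phi a c - phi a' c) ->
  (forall g g' h a c c', deg A g g' a -> deg C g' h c -> deg C g' h c' ->
     phi a (c - c') = phi a c - phi a c') ->
  (forall g g' h b a c, deg A g g' a -> deg C g' h c ->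
     phi (bg_s A b * a) c = phi a (bg_r C b * c)) ->
  zmod_morphism (flift phi) /\
  forall g g' h a c, deg A g g' a -> deg C g' h c ->
    flift phi (fpure a c) = phi a c.
Proof.
move=> h1 h2 h3.
have [Phi PhiB PhiE] := fiber_lift_ex
  (phi := fun g g' h a c => phi a c) h1 h2 h3.
have fE u : flift phi u = Phi u.
  rewrite [in RHS](sweedlerE u) (zmod_morphism_sum _ _ PhiB) /flift.
  rewrite big_seq [RHS]big_seq; apply: eq_bigr => x /sweedler_matching.
  by move=> [g [g' [h [ha hc]]]]; rewrite (PhiE _ _ _ _ _ ha hc).
split=> [u w|g g' h a c ha hc]; first by rewrite !fE; exact: PhiB.
by rewrite fE (PhiE _ _ _ _ _ ha hc).
Qed.

Definition fmap (A C A' C' : bgAlg B) (f : A -> A') (g : C -> C') :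
  fiber A C -> fiber A' C' := flift (fun a c => fpure (f a) (g c)).

Definition fassoc (A C D : bgAlg B) :
  fiber (fiber A C) D -> fiber A (fiber C D) :=
  flift (fun u d => flift (fun a c => fpure a (fpure c d : fiber C D)) u).

(* The linear maps b g |-> r(b) and b g |-> s(b). *)
Definition r_hat (A : bgAlg B) (u : cross B) : A :=
  symlift (fun x : cross_symbols B => bg_r A x.1) u.
Definition s_hat (A : bgAlg B) (u : cross B) : A :=
  symlift (fun x : cross_symbols B => bg_s A x.1) u.
(* The linear map g b |-> s(b); note b g = g (g^-1 b) in the crossed product. *)
Definition s_check (A : bgAlg B) (u : cross B) : A :=
  symlift (fun x : cross_symbols B => bg_s A (act x.2^-1%g x.1)) u.

Definition funitl (A : bgAlg B) : fiber (cross B) A -> A :=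
  flift (fun u a => r_hat A u * a).
Definition funitr (A : bgAlg B) : fiber A (cross B) -> A :=
  flift (fun a u => s_hat A u * a).

Record hopf_data (A : bgAlg B) := HopfData {
  hDelta : A -> fiber A A;
  heps : A -> cross B;
  hS : A -> coop A
}.

Definition is_hopf_algebroid (A : bgAlg B) (D : hopf_data A) : Prop :=
  let Delta := hDelta D in let eps := heps D in let S := hS D in
  [/\ bg_hom Delta, bg_hom eps & bg_hom S] /\
  [/\ forall a, fassoc (fmap Delta id (Delta a)) = fmap id Delta (Delta a),
      forall a, funitl (fmap eps id (Delta a)) = a,
      forall a, funitr (fmap id eps (Delta a)) = a,
      forall a, flift (fun a1 a2 => (S a1 : A) * a2) (Delta a) =
                s_check A (eps a) &
      forall a, flift (fun a1 a2 => a1 * (S a2 : A)) (Delta a) =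
                r_hat A (eps a)].

End FiberMaps.

Definition mx_inverse (R : pzRingType) (n : nat) (v w : 'M[R]_n) : Prop :=
  v *m w = 1%:M /\ w *m v = 1%:M.

Section UniversalAlgebra.
Variables (k : fieldType) (Gam : groupType) (B : gammaAlg k Gam).
Variables (n : nat) (gam : 'I_n -> Gam) (F : 'M[B]_n).

Definition nabla : 'M[cross B]_n := diag_mx (\row_i cpure 1 (gam i)).

(* G is nabla F nabla, as a matrix over B. *)
Definition is_nabla_conj (G : 'M[B]_n) : Prop :=
  nabla *m map_mx (@cross_emb k Gam B) F *m nabla =
  map_mx (@cross_emb k Gam B) G.

(* v is invertible of degree (gam_i, gam_j), and r(G) v^-T = v s(F). *)
Definition orth_matrix (G : 'M[B]_n) (C : bgAlg B) (v : 'M[C]_n) : Prop :=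
  (forall i j, deg C (gam i) (gam j) (v i j)) /\
  exists2 w : 'M[C]_n, mx_inverse v w &
    map_mx (bg_r C) G *m w^T = v *m map_mx (bg_s C) F.

Definition is_universal_orth (G : 'M[B]_n) (A : bgAlg B) (v : 'M[A]_n) : Prop :=
  orth_matrix G v /\
  forall (C : bgAlg B) (u : 'M[C]_n), orth_matrix G u ->
    exists! f : A -> C, bg_hom f /\ map_mx f v = u.

End UniversalAlgebra.

(* Universal pairs (A, v) exist: linear combinations of words in the letters
   r(b), s(b), v_ij and (v^-1)_ij, modulo the relations that hold in every
   (B, Gam)-algebra containing a matrix as required. *)
Section Existence.
Variables (k : fieldType) (Gam : groupType) (B : gammaAlg k Gam).
Variables (n : nat) (gam : 'I_n -> Gam) (F G : 'M[B]_n).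

Lemma mx_inverse_uniq (R : pzRingType) (v w w' : 'M[R]_n) :
  mx_inverse v w -> mx_inverse v w' -> w = w'.
Proof.
by move=> [_ wv] [vw' _]; rewrite -[LHS]mulmx1 -vw' mulmxA wv mul1mx.
Qed.

Lemma compMl (C : bgAlg B) g h (x y : C) d : deg C g h x ->
  comp (x * y) (g * d.1, h * d.2)%g = x * comp y d.
Proof.
move=> hx; have [uy hy y0 ey] := compP y.
pose s (e : Gam * Gam) := (g * e.1, h * e.2)%g.
pose s' (e : Gam * Gam) := (g^-1 * e.1, h^-1 * e.2)%g.
have sK : cancel s s' by case=> a b; rewrite /s /s' /= !mulKg.
have s'K : cancel s' s by case=> a b; rewrite /s /s' /= !mulVKg.
rewrite -[d in RHS]sK.
apply: (@comp_eq _ _ _ _ _ [seq s e | e <- compsupp y] (fun e => x * comp y (s' e))).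
split=> [|e|e|].
- by rewrite map_inj_uniq //; exact: can_inj sK.
- by have := degM hx (hy (s' e)); rewrite /s' /= !mulVKg.
- move=> es; rewrite y0 ?mulr0 //; apply: contra es => es.
  by rewrite -[e]s'K map_f.
- by rewrite big_map {1}ey mulr_sumr; apply: eq_bigr => e _; rewrite sK.
Qed.

Lemma inv_deg (C : bgAlg B) (v w : 'M[C]_n) :
  (forall i j, deg C (gam i) (gam j) (v i j)) -> mx_inverse v w ->
  forall i j, deg C (gam j)^-1%g (gam i)^-1%g (w i j).
Proof.
move=> hv [vw wv] i j.
pose w' : 'M[C]_n := \matrix_(i, j) comp (w i j) ((gam j)^-1, (gam i)^-1)%g.
have vw' : v *m w' = 1%:M.
  apply/matrixP=> a b.
  transitivity (comp ((v *m w) a b) (gam a * (gam b)^-1, 1)%g).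
    rewrite !mxE (zmod_morphism_sum (f := fun x => comp x _)); last first.
      by move=> x y; exact: compB.
    apply: eq_bigr => c _; rewrite mxE -(compMl _ _ (hv a c)) /=.
    by rewrite mulgV.
  rewrite vw !mxE; case: eqP => [->|_] /=.
    by rewrite (comp_hom _ (deg_one C)) mulgV eqxx.
  by rewrite (comp_hom _ (deg0 C 1%g 1%g)) if_same.
have -> : w = w' by rewrite -[LHS]mulmx1 -vw' mulmxA wv mul1mx.
rewrite mxE; exact: (comp_deg _ (_, _)).
Qed.

Definition letter : choiceType := (B + B + ('I_n * 'I_n + 'I_n * 'I_n))%type.
Definition l_r (b : B) : letter := inl (inl b).
Definition l_s (b : B) : letter := inl (inr b).
Definition l_v (i j : 'I_n) : letter := inr (inl (i, j)).
Definition l_w (i j : 'I_n) : letter := inr (inr (i, j)).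

Definition letter_deg (l : letter) : Gam * Gam :=
  match l with
  | inl _ => (1, 1)%g
  | inr (inl (i, j)) => (gam i, gam j)
  | inr (inr (i, j)) => ((gam j)^-1, (gam i)^-1)%g
  end.
Definition word_deg (s : seq letter) : Gam * Gam :=
  foldr (fun l d => ((letter_deg l).1 * d.1, (letter_deg l).2 * d.2)%g) (1, 1)%g s.

Record model := Model {
  m_alg :> bgAlg B;
  m_v : 'M[m_alg]_n;
  m_w : 'M[m_alg]_n;
  m_deg : forall i j, deg m_alg (gam i) (gam j) (m_v i j);
  m_inv : mx_inverse m_v m_w;
  m_rel : map_mx (bg_r m_alg) G *m m_w^T = m_v *m map_mx (bg_s m_alg) F
}.

Implicit Types M : model.

Definition ev_letter (M : model) (l : letter) : M :=
  match l with
  | inl (inl b) => bg_r M b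
  | inl (inr b) => bg_s M b
  | inr (inl (i, j)) => m_v M i j
  | inr (inr (i, j)) => m_w M i j
  end.
Definition ev (M : model) (x : k * seq letter) : M :=
  in_pzalg x.1 * \prod_(l <- x.2) ev_letter M l.

Lemma ev_letter_deg M l : deg M (letter_deg l).1 (letter_deg l).2 (ev_letter M l).
Proof.
case: l => [[b|b]|[[i j]|[i j]]] /=.
- exact: bg_r_deg.
- exact: bg_s_deg.
- exact: m_deg.
- by apply: inv_deg (m_inv M) _ _; exact: m_deg.
Qed.

Lemma ev_deg M x : deg M (word_deg x.2).1 (word_deg x.2).2 (ev M x).
Proof.
apply: degK; case: x => c s /=; elim: s => [|l s IH] /=.
  by rewrite big_nil; exact: deg_one.
by rewrite big_cons; apply: degM IH; exact: ev_letter_deg.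
Qed.

Definition wordM (x y : k * seq letter) := (x.1 * y.1, x.2 ++ y.2).
Definition wordN (x : k * seq letter) := (- x.1, x.2).
Definition wordK (c : k) : k * seq letter := (c, [::]).
Definition word_adm (V : zmodType) (phi : k * seq letter -> V) : Prop :=
  exists (M : model) (psi : M -> V), zmod_morphism psi /\ phi =1 psi \o ev M.

Lemma evM M x y : ev M (wordM x y) = ev M x * ev M y.
Proof.
rewrite /ev /wordM /= rmorphM big_cat /= -!mulrA; congr (_ * _).
by rewrite mulrA in_pzalgC !mulrA.
Qed.

Lemma wordMA : associative wordM.
Proof. by move=> x y z; rewrite /wordM /= mulrA catA. Qed.
Lemma word1M : left_id (1, [::]) wordM.
Proof. by case=> c s; rewrite /wordM /= mul1r. Qed.
Lemma wordM1 : right_id (1, [::]) wordM.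
Proof. by case=> c s; rewrite /wordM /= mulr1 cats0. Qed.
Lemma wordKC c x : wordM (wordK c) x = wordM x (wordK c).
Proof. by rewrite /wordM /= cats0 mulrC. Qed.
Lemma wordKM b c : wordK (b * c) = wordM (wordK b) (wordK c).
Proof. by []. Qed.
Lemma word_admN (V : zmodType) (phi : k * seq letter -> V) x :
  word_adm phi -> phi (wordN x) = - phi x.
Proof.
move=> [M [psi [pB e]]]; rewrite !e /= /ev /= rmorphN mulNr.
exact: (zmod_morphismN pB).
Qed.
Lemma word_admKD (V : zmodType) (phi : k * seq letter -> V) b c :
  word_adm phi -> phi (wordK (b + c)) = phi (wordK b) + phi (wordK c).
Proof.
move=> [M [psi [pB e]]]; rewrite !e /= /ev /= rmorphD mulrDl.
exact: (zmod_morphismD pB).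
Qed.
Lemma word_admMl (V : zmodType) (phi : k * seq letter -> V) x :
  word_adm phi -> word_adm (fun y => phi (wordM x y)).
Proof.
move=> [M [psi [pB e]]]; exists M, (fun y => psi (ev M x * y)); split.
  by move=> a b; rewrite mulrBr pB.
by move=> y; rewrite e /= evM.
Qed.
Lemma word_admMr (V : zmodType) (phi : k * seq letter -> V) y :
  word_adm phi -> word_adm (fun x => phi (wordM x y)).
Proof.
move=> [M [psi [pB e]]]; exists M, (fun x => psi (x * ev M y)); split.
  by move=> a b; rewrite mulrBl pB.
by move=> x; rewrite e /= evM.
Qed.

Definition word_symbols : symbols k :=
  Symbols wordMA word1M wordM1 wordKC (erefl (wordK 1)) wordKM
    word_admN word_admKD word_admMl word_admMr.
Definition orth_alg : pzAlgType k := symalg word_symbols.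
Definition wpure (c : k) (s : seq letter) : orth_alg :=
  @sympure k word_symbols (c, s).

Lemma ev_adm M : @admissible k word_symbols M (ev M).
Proof. by exists M, id; split. Qed.
Definition Ev (M : model) (u : orth_alg) : M :=
  symlift (ev M : word_symbols -> M) u.
Lemma EvB M : zmod_morphism (Ev M).
Proof. exact: (symlift_zmod (ev_adm M)). Qed.
Lemma Ev_pure M c s : Ev M (wpure c s) = ev M (c, s).
Proof. exact: (symlift_pure (ev_adm M)). Qed.
Lemma Ev_sum (u : orth_alg) :
  u = \sum_(x <- (repr u : seq (k * seq letter))) wpure x.1 x.2.
Proof. by rewrite [LHS]symalg_sum; apply: eq_bigr; case. Qed.
Lemma wpureM c s d t : wpure c s * wpure d t = wpure (c * d) (s ++ t).
Proof. exact: sympureM. Qed.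
Lemma EvM M : {morph Ev M : u w / u * w}.
Proof.
move=> u w; rewrite (Ev_sum u) (Ev_sum w) mulr_suml !(zmod_morphism_sum _ _ (EvB M)).
rewrite mulr_suml; apply: eq_bigr => x _; rewrite !mulr_sumr.
rewrite (zmod_morphism_sum _ _ (EvB M)); apply: eq_bigr => y _.
by rewrite wpureM !Ev_pure -evM.
Qed.
Lemma Ev_in M c : Ev M (in_pzalg c) = in_pzalg c.
Proof. by rewrite [LHS]Ev_pure /ev /= big_nil mulr1. Qed.
Lemma Ev_hom M : alg_hom (Ev M).
Proof.
split; [exact: EvB | split; [|exact: EvM] | exact: Ev_in].
by rewrite -(rmorph1 (@in_pzalg k orth_alg)) Ev_in rmorph1.
Qed.
Lemma Ev_ext (u w : orth_alg) : (forall M, Ev M u = Ev M w) -> u = w.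
Proof.
move=> h; apply: symalg_ext => V phi [M [psi [pB e]]].
have symE (a : orth_alg) : symlift phi a = psi (Ev M a).
  rewrite /symlift /Ev /symlift (zmod_morphism_sum _ _ pB).
  by apply: eq_bigr => x _; rewrite e.
by rewrite !symE h.
Qed.

Definition orth_deg (g h : Gam) (u : orth_alg) : Prop :=
  exists2 l : seq (k * seq letter), (forall x, x \in l -> word_deg x.2 = (g, h)) &
    u = \sum_(x <- l) wpure x.1 x.2.
Definition orth_r (b : B) : orth_alg := wpure 1 [:: l_r b].
Definition orth_s (b : B) : orth_alg := wpure 1 [:: l_s b].

Lemma wpureN c s : wpure (- c) s = - wpure c s.
Proof.
apply: Ev_ext => M; rewrite (zmod_morphismN (EvB M)) !Ev_pure /ev /=.
by rewrite rmorphN mulNr.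
Qed.
Lemma word_deg_cat s t : word_deg (s ++ t) =
  ((word_deg s).1 * (word_deg t).1, (word_deg s).2 * (word_deg t).2)%g.
Proof.
elim: s => [|l s IH] /=; first by rewrite !mul1g -surjective_pairing.
by rewrite IH /= !mulgA.
Qed.
Lemma orth_deg0 g h : orth_deg g h 0.
Proof. by exists [::] => //; rewrite big_nil. Qed.
Lemma orth_degB g h u w : orth_deg g h u -> orth_deg g h w -> orth_deg g h (u - w).
Proof.
move=> [l hl ->] [m hm ->]; exists (l ++ [seq wordN x | x <- m]).
  by move=> x; rewrite mem_cat => /orP[/hl //|/mapP[y /hm + ->]].
rewrite big_cat big_map -sumrN /=; congr (_ + _).
by apply: eq_bigr => x _; rewrite wpureN.
Qed.
Lemma orth_degM g h g' h' u w : orth_deg g h u -> orth_deg g' h' w ->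
  orth_deg (g * g')%g (h * h')%g (u * w).
Proof.
move=> [l hl ->] [m hm ->]; exists [seq wordM x y | x <- l, y <- m].
  move=> _ /allpairsP[[x y] /= [/hl ex /hm ey ->]].
  by rewrite word_deg_cat ex ey.
rewrite big_allpairs_dep mulr_suml; apply: eq_bigr => x _.
by rewrite mulr_sumr; apply: eq_bigr => y _; rewrite wpureM.
Qed.
Lemma orth_deg_pure c s : orth_deg (word_deg s).1 (word_deg s).2 (wpure c s).
Proof.
exists [:: (c, s)]; last by rewrite big_seq1.
by move=> x; rewrite inE => /eqP ->; rewrite -surjective_pairing.
Qed.
Lemma orth_degK g h c u : orth_deg g h u -> orth_deg g h (in_pzalg c * u).
Proof. by move=> /(orth_degM (orth_deg_pure c [::])); rewrite /= !mul1g. Qed.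
Lemma orth_deg_span u : exists2 l : seq (Gam * Gam * orth_alg),
  (forall p, p \in l -> orth_deg p.1.1 p.1.2 p.2) & u = \sum_(p <- l) p.2.
Proof.
exists [seq (word_deg x.2, wpure x.1 x.2) | x <- (repr u : seq (k * seq letter))].
  by move=> _ /mapP[x _ ->] /=; exact: orth_deg_pure.
by rewrite big_map; exact: Ev_sum.
Qed.
Lemma Ev_deg M g h u : orth_deg g h u -> deg M g h (Ev M u).
Proof.
move=> [l hl ->]; rewrite (zmod_morphism_sum _ _ (EvB M)) big_seq.
apply: deg_sum => x /hl ex; rewrite Ev_pure.
by have := ev_deg M (x.1, x.2); rewrite /= ex.
Qed.
Lemma orth_deg_indep (t : seq (Gam * Gam)) (z : Gam * Gam -> orth_alg) :
  uniq t -> (forall d, orth_deg d.1 d.2 (z d)) -> \sum_(d <- t) z d = 0 ->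
  forall d, d \in t -> z d = 0.
Proof.
move=> ut hz sz0 d dt; apply: Ev_ext => M; rewrite (zmod_morphism0 (EvB M)).
apply: (deg_indep ut (z := fun d => Ev M (z d))) => //.
  by move=> e; exact: Ev_deg.
by rewrite -(zmod_morphism_sum _ _ (EvB M)) sz0 (zmod_morphism0 (EvB M)).
Qed.
Lemma Ev_r M b : Ev M (orth_r b) = bg_r M b.
Proof. by rewrite Ev_pure /ev /= rmorph1 mul1r big_seq1. Qed.
Lemma Ev_s M b : Ev M (orth_s b) = bg_s M b.
Proof. by rewrite Ev_pure /ev /= rmorph1 mul1r big_seq1. Qed.
Lemma orth_r_hom : alg_hom orth_r.
Proof.
split=> [b c| |c]; last first.
- by apply: Ev_ext => M; rewrite Ev_r (alg_homK (bg_r_hom M)) Ev_in.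
- split=> [|b c]; apply: Ev_ext => M.
    by rewrite Ev_r (alg_hom1 (bg_r_hom M)) (alg_hom1 (Ev_hom M)).
  by rewrite EvM !Ev_r (alg_homM (bg_r_hom M)).
- by apply: Ev_ext => M; rewrite EvB !Ev_r (alg_homB (bg_r_hom M)).
Qed.
Lemma orth_s_hom : alg_hom orth_s.
Proof.
split=> [b c| |c]; last first.
- by apply: Ev_ext => M; rewrite Ev_s (alg_homK (bg_s_hom M)) Ev_in.
- split=> [|b c]; apply: Ev_ext => M.
    by rewrite Ev_s (alg_hom1 (bg_s_hom M)) (alg_hom1 (Ev_hom M)).
  by rewrite EvM !Ev_s (alg_homM (bg_s_hom M)).
- by apply: Ev_ext => M; rewrite EvB !Ev_s (alg_homB (bg_s_hom M)).
Qed.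
Lemma orth_r_deg b : orth_deg 1%g 1%g (orth_r b).
Proof. by have := orth_deg_pure 1 [:: l_r b]; rewrite /= mulg1. Qed.
Lemma orth_s_deg b : orth_deg 1%g 1%g (orth_s b).
Proof. by have := orth_deg_pure 1 [:: l_s b]; rewrite /= mulg1. Qed.
Lemma orth_rsC b b' : orth_r b * orth_s b' = orth_s b' * orth_r b.
Proof. by apply: Ev_ext => M; rewrite !EvM Ev_r Ev_s bg_rsC. Qed.
Lemma orth_rE g h u b : orth_deg g h u -> u * orth_r b = orth_r (act g b) * u.
Proof.
by move=> hu; apply: Ev_ext => M; rewrite !EvM !Ev_r (bg_rE _ (Ev_deg M hu)).
Qed.
Lemma orth_sE g h u b : orth_deg g h u -> u * orth_s b = orth_s (act h b) * u.
Proof.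
by move=> hu; apply: Ev_ext => M; rewrite !EvM !Ev_s (bg_sE _ (Ev_deg M hu)).
Qed.

Definition orth : bgAlg B :=
  BGAlg orth_deg0 orth_degB orth_degK orth_degM orth_deg_span orth_deg_indep
    orth_r_hom orth_s_hom orth_r_deg orth_s_deg orth_rsC orth_rE orth_sE.

Definition orth_v : 'M[orth]_n := \matrix_(i, j) wpure 1 [:: l_v i j].
Definition orth_w : 'M[orth]_n := \matrix_(i, j) wpure 1 [:: l_w i j].

Lemma Ev_v M : map_mx (Ev M) orth_v = m_v M.
Proof.
by apply/matrixP=> i j; rewrite !mxE Ev_pure /ev /= rmorph1 mul1r big_seq1.
Qed.
Lemma Ev_w M : map_mx (Ev M) orth_w = m_w M.
Proof.
by apply/matrixP=> i j; rewrite !mxE Ev_pure /ev /= rmorph1 mul1r big_seq1.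
Qed.

Lemma map_mxM_hom (R S : pzAlgType k) (f : R -> S) (X Y : 'M[R]_n) :
  alg_hom f -> map_mx f (X *m Y) = map_mx f X *m map_mx f Y.
Proof.
move=> hf; apply/matrixP=> i j; rewrite !mxE.
rewrite (zmod_morphism_sum (f := f)); last by case: hf.
by apply: eq_bigr => a _; rewrite !mxE (alg_homM hf).
Qed.
Lemma map_mx1_hom (R S : pzAlgType k) (f : R -> S) :
  alg_hom f -> map_mx f (1%:M : 'M[R]_n) = 1%:M.
Proof.
move=> hf; apply/matrixP=> i j; rewrite !mxE; case: eqP => _ /=.
  exact: alg_hom1.
exact: alg_hom0.
Qed.

Lemma Ev_mx_ext (X Y : 'M[orth]_n) :
  (forall M, map_mx (Ev M) X = map_mx (Ev M) Y) -> X = Y.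
Proof.
move=> h; apply/matrixP => i j; apply: Ev_ext => M.
by have /matrixP/(_ i j) := h M; rewrite !mxE.
Qed.

Lemma orth_inv : mx_inverse orth_v orth_w.
Proof.
split; apply: Ev_mx_ext => M; rewrite (map_mxM_hom _ _ (Ev_hom M)) Ev_v Ev_w;
  rewrite (map_mx1_hom (Ev_hom M)); by case: (m_inv M).
Qed.

Lemma orth_orth : orth_matrix gam F G orth_v.
Proof.
split=> [i j|].
  by rewrite mxE; have := orth_deg_pure 1 [:: l_v i j]; rewrite /= !mulg1.
exists orth_w; first exact: orth_inv.
apply: Ev_mx_ext => M; rewrite !(map_mxM_hom _ _ (Ev_hom M)) Ev_v.
rewrite -map_trmx Ev_w -!map_mx_comp.
have -> : map_mx (Ev M \o bg_r orth) G = map_mx (bg_r M) G.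
  by apply/matrixP=> i j; rewrite !mxE; exact: Ev_r.
have -> : map_mx (Ev M \o bg_s orth) F = map_mx (bg_s M) F.
  by apply/matrixP=> i j; rewrite !mxE; exact: Ev_s.
exact: m_rel.
Qed.

Lemma universal_orth_exists :
  exists (A : bgAlg B) (v : 'M[A]_n), is_universal_orth gam F G v.
Proof.
exists orth, orth_v; split; first exact: orth_orth.
move=> C u [hu [w uw rel]]; pose M := Model hu uw rel.
exists (Ev M); split.
  split; last exact: (Ev_v M).
  split; [exact: (Ev_hom M) | by move=> *; exact: (@Ev_deg M) | exact: (Ev_r M) | exact: (Ev_s M)].
move=> f [[fh fd fr fs] fv]; apply/funext => x.
have fw : map_mx f orth_w = w.
  apply: (mx_inverse_uniq _ uw); rewrite -fv; have [h1 h2] := orth_inv.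
  by split; rewrite -(map_mxM_hom _ _ fh) ?h1 ?h2 (map_mx1_hom fh).
rewrite (Ev_sum x) (zmod_morphism_sum _ _ (EvB M)).
have fB : zmod_morphism f by case: fh.
rewrite (zmod_morphism_sum _ _ fB); apply: eq_bigr => -[c s] _ /=.
rewrite Ev_pure /ev /=.
have -> : wpure c s = in_pzalg c * wpure 1 s.
  by rewrite [RHS]wpureM mulr1.
rewrite (alg_homM fh) (alg_homK fh); congr (_ * _).
elim: s => [|l s IH]; first by rewrite big_nil; exact: (esym (alg_hom1 fh)).
have -> : wpure 1 (l :: s) = wpure 1 [:: l] * wpure 1 s.
  by rewrite wpureM mulr1.
rewrite big_cons (alg_homM fh) -IH; congr (_ * _).
case: l => [[b|b]|[[i j]|[i j]]] /=.
- exact: (esym (fr b)).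
- exact: (esym (fs b)).
- by rewrite -fv !mxE.
- by rewrite -fw !mxE.
Qed.

End Existence.

(* Main.v *)
Require Import Defs.
From mathcomp Require Import all_boot all_algebra.
From mathcomp Require Import boolp.

(* Universality yields Delta, epsilon and S as soon as the matrices
   (sum_l v_il (x) v_lj), diag(gam_i) and v^-1, the last one over the
   co-opposite algebra, satisfy the defining relations of v.  For v^-1 this uses
   that G = nabla F nabla is invertible over B, so that r(G) v^-T = v s(F) makes
   v^-T invertible.  Coassociativity and the counit laws compare morphisms
   A -> C, hence only need to be checked on v.  The two antipode axioms are not
   of this kind; the elements satisfying one of them are stable under
   multiplication by homogeneous elements satisfying it, and A is generated by
   r(B), s(B) and the entries of v and v^-1. *)

Set Implicit Arguments.
Unset Strict Implicit.
Unset Printing Implicit Defensive.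

Import GRing.Theory.
Local Open Scope ring_scope.

(** * Maps out of the fiber product *)

Section FiberCalculus.
Variables (k : fieldType) (Gam : groupType) (B : gammaAlg k Gam).
Implicit Types (A C D E : bgAlg B).

(** The [nabla]-oddness of [F] works through degrees. Entrywise it says G_ij = gam_i(F_ij), with
    F_ij = G_ij = 0 unless gam_i gam_j = e. In the relation for v, the summands r(G_il) w_jl and
    v_il s(F_lj) therefore have a degree independent of l, so they can be legs of matching tensors,
    and moving s(F_ij) to the left across v_li turns it into s(G_ij). The antipode axioms resist the
    comparison of morphisms because a |-> sum S(a_1) a_2 is not multiplicative: on a product a a' it
    nests as S(a'_1) S(a_1) a_2 a'_2. An inner value s(b) can be pulled out only by letting the
    degree of a'_1 act on b, hence the restriction to homogeneous factors. *)

Lemma degN A g h (x : A) : deg A g h x -> deg A g h (- x).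
Proof. by move=> hx; rewrite -sub0r; apply: degB => //; exact: deg0. Qed.

(** No degree is asked of [c]: the tensor vanishes already over [k], so the default value of
    [insubd] does not matter. *)
Lemma fpure0l A C (c : C) : fpure (0 : A) c = 0.
Proof.
have [t1 _ _] := tpure_admissible A C.
rewrite /fpure (zmod_morphism0 (t1 c)).
have -> : insubd 0 0 = 0 :> gam_tens_type A C.
  by apply: val_inj; rewrite insubdK //; exact: (valP (0 : gam_tens_type A C)).
exact: raddf0.
Qed.

Lemma fpure0r A C (a : A) : fpure a (0 : C) = 0.
Proof.
have [_ t2 _] := tpure_admissible A C.
rewrite /fpure (zmod_morphism0 (t2 a)).
have -> : insubd 0 0 = 0 :> gam_tens_type A C.
  by apply: val_inj; rewrite insubdK //; exact: (valP (0 : gam_tens_type A C)).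
exact: raddf0.
Qed.

Lemma fpureDl A C g g' h (a a' : A) (c : C) :
  deg A g g' a -> deg A g g' a' -> deg C g' h c ->
  fpure (a + a') c = fpure a c + fpure a' c.
Proof.
move=> ha ha' hc; have := fpureBl (deg0 A g g') ha' hc.
rewrite fpure0l !sub0r => e.
by rewrite -{1}[a']opprK (fpureBl ha (degN ha') hc) e opprK.
Qed.

Lemma fpureDr A C g g' h (a : A) (c c' : C) :
  deg A g g' a -> deg C g' h c -> deg C g' h c' ->
  fpure a (c + c') = fpure a c + fpure a c'.
Proof.
move=> ha hc hc'; have := fpureBr ha (deg0 C g' h) hc'.
rewrite fpure0r !sub0r => e.
by rewrite -{1}[c']opprK (fpureBr ha hc (degN hc')) e opprK.
Qed.

Lemma fpure_suml A C g g' h (I : finType) (a : I -> A) (c : C) :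
  (forall i, deg A g g' (a i)) -> deg C g' h c ->
  fpure (\sum_i a i) c = \sum_i fpure (a i) c.
Proof.
move=> ha hc; elim: (index_enum I) => [|i r IH].
  by rewrite !big_nil fpure0l.
rewrite !big_cons -IH; apply: fpureDl hc => //.
by apply: deg_sum => j _; exact: ha.
Qed.

Lemma fpure_sumr A C g g' h (I : finType) (a : A) (c : I -> C) :
  deg A g g' a -> (forall i, deg C g' h (c i)) ->
  fpure a (\sum_i c i) = \sum_i fpure a (c i).
Proof.
move=> ha hc; elim: (index_enum I) => [|i r IH].
  by rewrite !big_nil fpure0r.
rewrite !big_cons -IH; apply: fpureDr ha _ _ => //.
by apply: deg_sum => j _; exact: hc.
Qed.

Lemma deg_fpure A C g g' h (a : A) (c : C) :
  deg A g g' a -> deg C g' h c -> deg (fiber A C) g h (fpure a c).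
Proof. exact: fiber_deg_pure. Qed.

Lemma fiber_rM A C g g' h b (a : A) (c : C) : deg A g g' a -> deg C g' h c ->
  bg_r (fiber A C) b * fpure a c = fpure (bg_r A b * a) c.
Proof.
by move=> ha hc; rewrite [LHS](fpureM (bg_r_deg A b) (deg_one C) ha hc) mul1r.
Qed.

Lemma fiber_Ms A C g g' h b (a : A) (c : C) : deg A g g' a -> deg C g' h c ->
  fpure a c * bg_s (fiber A C) b = fpure a (c * bg_s C b).
Proof.
by move=> ha hc; rewrite [LHS](fpureM ha hc (deg_one A) (bg_s_deg C b)) mulr1.
Qed.

(* The map tpure a c |-> tpure a_(p, q) c_(p', q') on A (x) C kills the matching
   tensors as soon as q <> p'. *)
Lemma fpure_mismatch A C p q p' q' (a : A) (c : C) :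
  deg A p q a -> deg C p' q' c -> q <> p' -> fpure a c = 0.
Proof.
move=> ha hc n; rewrite /fpure.
suff -> : insubd 0 (tpure a c) = 0 :> gam_tens_type A C by exact: raddf0.
(* Outside [gam_tens] the class is that of the default value 0; inside, the tensor itself is shown
   to vanish. *)
have [tin|tnin] := boolP (tpure a c \in @gam_tens _ _ _ A C); last first.
  by rewrite /insubd insubN.
apply: val_inj; rewrite insubdK //.
have [t1 t2 t3] := tpure_admissible A C.
pose f : tens_symbols A C -> tens A C :=
  fun x : A * C => tpure (Defs.comp x.1 (p, q)) (Defs.comp x.2 (p', q')).
have f_adm : admissible f.
  split=> [c0 a1 a2|a0 c1 c2|l a0 c0]; rewrite /f /=.
  - by rewrite compB; exact: t1.
  - by rewrite compB; exact: t2.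
  - by rewrite !compK; exact: t3.
have f_pure (a0 : A) (c0 : C) : symlift f (tpure a0 c0) = f (a0, c0).
  by rewrite symlift_pure.
have -> : tpure a c = symlift f (tpure a c).
  by rewrite f_pure /f /= (comp_hom _ ha) (comp_hom _ hc) !eqxx.
have /asboolP[l hl ->] := tin.
rewrite (zmod_morphism_sum _ _ (symlift_zmod f_adm)) big_seq big1 //.
move=> x /hl[g [g' [h [h1 h2]]]].
rewrite f_pure /f /= (comp_hom _ h1) (comp_hom _ h2).
case: eqP => [[_ e]|_]; last exact: (zmod_morphism0 (t1 _)).
case: eqP => [[e' _]|_]; last exact: (zmod_morphism0 (t2 _)).
by case: n; rewrite e e'.
Qed.

(** Matching pure tensors generate the fiber product additively, and the unit and the scalars are
    values of [r], so the condition on [r] covers them. *)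
Lemma bg_hom_fiber A C E (f : fiber A C -> E) : zmod_morphism f ->
  (forall g g' h a c i i' j a' c', deg A g g' a -> deg C g' h c ->
     deg A i i' a' -> deg C i' j c' ->
     f (fpure (a * a') (c * c')) = f (fpure a c) * f (fpure a' c')) ->
  (forall g g' h a c, deg A g g' a -> deg C g' h c -> deg E g h (f (fpure a c))) ->
  (forall b, f (fpure (bg_r A b) 1) = bg_r E b) ->
  (forall b, f (fpure 1 (bg_s C b)) = bg_s E b) ->
  bg_hom f.
Proof.
move=> fB fM fD fr fs; split=> // [|g h u].
  split=> // [|c].
    split; first by rewrite -fpure1 -(alg_hom1 (bg_r_hom A)) fr (alg_hom1 (bg_r_hom E)).
    move=> u w; have [l hl ->] := fpure_gen u; have [m hm ->] := fpure_gen w.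
    rewrite mulr_suml !(zmod_morphism_sum _ _ fB) mulr_suml big_seq [RHS]big_seq.
    apply: eq_bigr => x /hl[g [g' [h [h1 h2]]]].
    rewrite mulr_sumr !(zmod_morphism_sum _ _ fB) mulr_sumr big_seq [RHS]big_seq.
    apply: eq_bigr => y /hm[i [i' [j [h3 h4]]]].
    by rewrite (fpureM h1 h2 h3 h4) (fM _ _ _ _ _ _ _ _ _ _ h1 h2 h3 h4).
  by rewrite -fpure_in -(alg_homK (bg_r_hom A)) fr (alg_homK (bg_r_hom E)).
move=> [l hl ->]; rewrite (zmod_morphism_sum _ _ fB) big_seq.
by apply: deg_sum => x /hl[g' [h1 h2]]; exact: fD h1 h2.
Qed.

Section Fmap.
Variables (A C A' C' : bgAlg B) (f : A -> A') (g : C -> C').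
Hypotheses (hf : bg_hom f) (hg : bg_hom g).

Lemma fmap_lift : zmod_morphism (fmap f g) /\
  forall i j l a c, deg A i j a -> deg C j l c ->
    fmap f g (fpure a c) = fpure (f a) (g c).
Proof.
have [fh fd fr fs] := hf; have [gh gd gr gs] := hg; apply: fliftE.
- move=> i j l a a' c ha ha' hc; rewrite (alg_homB fh).
  exact: fpureBl (fd _ _ _ ha) (fd _ _ _ ha') (gd _ _ _ hc).
- move=> i j l a c c' ha hc hc'; rewrite (alg_homB gh).
  exact: fpureBr (fd _ _ _ ha) (gd _ _ _ hc) (gd _ _ _ hc').
- move=> i j l b a c ha hc; rewrite (alg_homM fh) (alg_homM gh) fs gr.
  exact: fpure_bal (fd _ _ _ ha) (gd _ _ _ hc).
Qed.

Lemma fmap_zmod : zmod_morphism (fmap f g).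
Proof. by case: fmap_lift. Qed.

Lemma fmapE i j l a c : deg A i j a -> deg C j l c ->
  fmap f g (fpure a c) = fpure (f a) (g c).
Proof. by case: fmap_lift => _; apply. Qed.

Lemma fmap_hom : bg_hom (fmap f g).
Proof.
have [fh fd fr fs] := hf; have [gh gd gr gs] := hg.
apply: bg_hom_fiber => [|i j l a c i' j' l' a' c' ha hc ha' hc'|i j l a c ha hc|b|b].
- exact: fmap_zmod.
- rewrite (fmapE ha hc) (fmapE ha' hc') (fmapE (degM ha ha') (degM hc hc')).
  rewrite (alg_homM fh) (alg_homM gh).
  by rewrite (fpureM (fd _ _ _ ha) (gd _ _ _ hc) (fd _ _ _ ha') (gd _ _ _ hc')).
- by rewrite (fmapE ha hc); apply: deg_fpure (fd _ _ _ ha) (gd _ _ _ hc).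
- by rewrite (fmapE (bg_r_deg A b) (deg_one C)) fr (alg_hom1 gh).
- by rewrite (fmapE (deg_one A) (bg_s_deg C b)) gs (alg_hom1 fh).
Qed.

End Fmap.

Section Assoc.
Variables (A C D : bgAlg B).

Let assoc_at (d : D) (a : A) (c : C) : fiber A (fiber C D) :=
  fpure a (fpure c d : fiber C D).

(** All degrees of [c] have to be allowed, not only those matching [d]: the chosen decomposition of
    a homogeneous element may contain summands of other degrees, which cancel. Their contribution is
    0 by [fpure_mismatch]. *)
Let assoc_at_lift p q d : deg D p q d -> zmod_morphism (flift (assoc_at d)) /\
  forall g g' h a c, deg A g g' a -> deg C g' h c ->
    flift (assoc_at d) (fpure a c) = assoc_at d a c.
Proof.
move=> hd; have cd h h' c : deg C h h' c -> deg (fiber C D) h q (fpure c d).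
  move=> hc; have [e|/eqP n] := eqVneq h' p.
    by apply: (deg_fpure hc); rewrite e.
  by rewrite (fpure_mismatch hc hd n); exact: deg0.
apply: fliftE => [g g' h a a' c ha ha' hc|g g' h a c c' ha hc hc'|g g' h b a c ha hc].
- exact: fpureBl ha ha' (cd _ _ _ hc).
- rewrite /assoc_at -(fpureBr ha (cd _ _ _ hc) (cd _ _ _ hc')); congr fpure.
  have [e|/eqP n] := eqVneq h p.
    by rewrite e in hc hc'; exact: fpureBl hc hc' hd.
  rewrite (fpure_mismatch hc hd n) (fpure_mismatch hc' hd n) subrr.
  exact: fpure_mismatch (degB hc hc') hd n.
- rewrite /assoc_at (fpure_bal b ha (cd _ _ _ hc)); congr fpure.
  have [e|/eqP n] := eqVneq h p.
    by rewrite e in hc; exact: fiber_rM hc hd.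
  rewrite (fpure_mismatch hc hd n) mulr0; have := degM (bg_r_deg C b) hc.
  by rewrite !mul1g => hbc; rewrite (fpure_mismatch hbc hd n).
Qed.

Lemma fassoc_lift : zmod_morphism (@fassoc _ _ _ A C D) /\
  forall g g' u d, deg (fiber A C) g g' u -> forall h, deg D g' h d ->
    fassoc (fpure u d) = flift (assoc_at d) u.
Proof.
suff [H1 H2] : zmod_morphism (@fassoc _ _ _ A C D) /\
  forall g g' h u d, deg (fiber A C) g g' u -> deg D g' h d ->
    fassoc (fpure u d) = flift (assoc_at d) u.
  by split=> // g g' u d hu h hd; exact: H2 hu hd.
apply: fliftE => [g g' h u u' d hu hu' hd|g g' h u d d' hu hd hd'|g g' h b u d hu hd].
- by have [aB _] := assoc_at_lift hd; rewrite aB.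
(* Additivity in [d] can be checked summand by summand, since the decomposition [sweedler u] does
   not depend on [d]. *)
- rewrite /flift -sumrB big_seq [RHS]big_seq; apply: eq_bigr => x.
  move=> /sweedler_matching[p [q [r [h1 h2]]]].
  have [e|/eqP n] := eqVneq r g'; last first.
    rewrite (fpure_mismatch h2 hd n) (fpure_mismatch h2 hd' n).
    by rewrite (fpure_mismatch h2 (degB hd hd') n) fpure0r subrr.
  rewrite e in h2; rewrite (fpureBr h2 hd hd').
  by rewrite (fpureBr h1 (deg_fpure h2 hd) (deg_fpure h2 hd')).
- have hbd : deg D g' h (bg_r D b * d).
    by have := degM (bg_r_deg D b) hd; rewrite !mul1g.
  (* The chosen decompositions of [u] and of s(b) u are unrelated, so both sides are evaluated on
     one decomposition of [u] through additivity. *)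
  have [aB aE] := assoc_at_lift hd; have [bB bE] := assoc_at_lift hbd.
  have [l hl ->] := fpure_gen u.
  rewrite mulr_sumr !(zmod_morphism_sum _ _ aB) !(zmod_morphism_sum _ _ bB).
  rewrite big_seq [RHS]big_seq; apply: eq_bigr => x /hl[p [q [r [h1 h2]]]].
  rewrite [_ * _](fpureM (deg_one A) (bg_s_deg C b) h1 h2) mul1r.
  have sh2 : deg C q r (bg_s C b * x.2).
    by have := degM (bg_s_deg C b) h2; rewrite !mul1g.
  rewrite [LHS](aE _ _ _ _ _ h1 sh2) [RHS](bE _ _ _ _ _ h1 h2).
  rewrite /assoc_at; congr fpure; have [e|/eqP n] := eqVneq r g'.
    by rewrite e in h2; exact: fpure_bal h2 hd.
  by rewrite (fpure_mismatch sh2 hd n) (fpure_mismatch h2 hbd n).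
Qed.

Lemma fassoc_zmod : zmod_morphism (@fassoc _ _ _ A C D).
Proof. by case: fassoc_lift. Qed.

Lemma fassocE g g' h j a c d : deg A g g' a -> deg C g' h c -> deg D h j d ->
  fassoc (fpure (fpure a c : fiber A C) d) = fpure a (fpure c d : fiber C D).
Proof.
move=> ha hc hd; have [_ fE] := fassoc_lift.
rewrite (fE _ _ _ _ (deg_fpure ha hc) _ hd).
by have [_ aE] := assoc_at_lift hd; rewrite (aE _ _ _ _ _ ha hc).
Qed.

(** The outer degrees stay fixed along the induction because additivity of [fpure] is available only
    for summands of equal degree. *)
Lemma fiber_deg_ind (P : fiber A C -> Prop) g h : P 0 ->
  (forall u w, deg (fiber A C) g h u -> deg (fiber A C) g h w ->
     P u -> P w -> P (u + w)) ->
  (forall g' a c, deg A g g' a -> deg C g' h c -> P (fpure a c)) ->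
  forall u, deg (fiber A C) g h u -> P u.
Proof.
move=> P0 PD Pp u [l + ->]; elim: l => [|x l IH] hl; first by rewrite big_nil.
have [g' [h1 h2]] := hl x (mem_head _ _).
have hl' y : y \in l -> exists g', deg A g g' y.1 /\ deg C g' h y.2.
  by move=> yl; apply: hl; rewrite inE yl orbT.
rewrite big_cons; apply: PD; [exact: deg_fpure h1 h2| |exact: Pp h1 h2|exact: IH].
by exists l.
Qed.

Lemma fassoc_hom : bg_hom (@fassoc _ _ _ A C D).
Proof.
have fB := fassoc_zmod.
have f0l d : fassoc (fpure (0 : fiber A C) d) = 0 :> fiber A (fiber C D).
  by rewrite fpure0l (zmod_morphism0 fB).
apply: bg_hom_fiber => //.
- move=> g g' h u d i i' j u' d' hu hd hu' hd'; move: u hu.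
  apply: fiber_deg_ind => [|u w hu hw IHu IHw|q a c ha hc].
  + by rewrite mul0r !f0l mul0r.
  + rewrite mulrDl (fpureDl (degM hu hu') (degM hw hu') (degM hd hd')).
    rewrite (fpureDl hu hw hd) !(zmod_morphismD fB) mulrDl.
    by rewrite IHu IHw.
  move: u' hu'; apply: fiber_deg_ind => [|u w hu hw IHu IHw|q' a' c' ha' hc'].
  + by rewrite mulr0 !f0l mulr0.
  + have h1 := deg_fpure ha hc.
    rewrite mulrDr (fpureDl (degM h1 hu) (degM h1 hw) (degM hd hd')).
    rewrite (fpureDl hu hw hd') !(zmod_morphismD fB) mulrDr.
    by rewrite IHu IHw.
  rewrite [_ * _](fpureM ha hc ha' hc').
  rewrite (fassocE (degM ha ha') (degM hc hc') (degM hd hd')).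
  rewrite (fassocE ha hc hd) (fassocE ha' hc' hd').
  rewrite (fpureM ha (deg_fpure hc hd) ha' (deg_fpure hc' hd')).
  by congr fpure; rewrite [RHS](fpureM hc hd hc' hd').
- move=> g g' h u d hu hd; move: u hu.
  apply: fiber_deg_ind => [|u w hu hw IHu IHw|q a c ha hc].
  + by rewrite f0l; exact: deg0.
  + by rewrite (fpureDl hu hw hd) (zmod_morphismD fB); exact: degD.
  + by rewrite (fassocE ha hc hd); apply: deg_fpure ha (deg_fpure hc hd).
- move=> b; rewrite [bg_r _ b]/(fpure (bg_r A b) 1).
  by rewrite (fassocE (bg_r_deg A b) (deg_one C) (deg_one D)) fpure1.
- move=> b; rewrite -{1}[1](fpure1 A C).
  by rewrite (fassocE (deg_one A) (deg_one C) (bg_s_deg D b)).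
Qed.

End Assoc.

End FiberCalculus.

(** * Counit maps and morphisms out of the universal algebra *)

Section Counit.
Variables (k : fieldType) (Gam : groupType) (B : gammaAlg k Gam) (A : bgAlg B).

Lemma r_hat_lift : zmod_morphism (@r_hat _ _ _ A) /\
  forall b g, r_hat A (cpure b g) = bg_r A b.
Proof.
have adm : @admissible _ (cross_symbols B) A (fun x => bg_r A x.1).
  by move=> g b c /=; exact: (alg_homB (bg_r_hom A)).
by split=> [|b g]; [exact: (symlift_zmod adm) | exact: (symlift_pure adm)].
Qed.

Lemma s_hat_lift : zmod_morphism (@s_hat _ _ _ A) /\
  forall b g, s_hat A (cpure b g) = bg_s A b.
Proof.
have adm : @admissible _ (cross_symbols B) A (fun x => bg_s A x.1).
  by move=> g b c /=; exact: (alg_homB (bg_s_hom A)).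
by split=> [|b g]; [exact: (symlift_zmod adm) | exact: (symlift_pure adm)].
Qed.

Lemma s_check_lift : zmod_morphism (@s_check _ _ _ A) /\
  forall b g, s_check A (cpure b g) = bg_s A (act g^-1%g b).
Proof.
have adm : @admissible _ (cross_symbols B) A
    (fun x => bg_s A (act x.2^-1%g x.1)).
  move=> g b c /=; rewrite (alg_homB (act_hom _)).
  exact: (alg_homB (bg_s_hom A)).
by split=> [|b g]; [exact: (symlift_zmod adm) | exact: (symlift_pure adm)].
Qed.

Lemma funitl_lift : zmod_morphism (@funitl _ _ _ A) /\
  forall g g' h u a, deg (cross B) g g' u -> deg A g' h a ->
    funitl (fpure u a) = r_hat A u * a.
Proof.
have [rB rE] := r_hat_lift; apply: fliftE => //.
- by move=> g g' h u u' a _ _ _; rewrite rB mulrBl.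
- by move=> g g' h u a a' _ _ _; rewrite mulrBr.
- move=> g g' h b u a [c -> _] _.
  rewrite [bg_s _ _ * _](cpureM b 1%g c g) !rE act1 mulrC mulrA.
  by rewrite (alg_homM (bg_r_hom A)).
Qed.

Lemma funitr_lift : zmod_morphism (@funitr _ _ _ A) /\
  forall g g' h a u, deg A g g' a -> deg (cross B) g' h u ->
    funitr (fpure a u) = s_hat A u * a.
Proof.
have [sB sE] := s_hat_lift; apply: fliftE => //.
- by move=> g g' h a a' u _ _ _; rewrite mulrBr.
- by move=> g g' h a u u' _ _ _; rewrite sB mulrBl.
- move=> g g' h b a u _ [c -> _].
  rewrite [bg_r _ _ * _](cpureM b 1%g c g') !sE act1 mulrA.
  by rewrite -(alg_homM (bg_s_hom A)) mulrC.
Qed.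

Lemma funitl_hom : bg_hom (@funitl _ _ _ A).
Proof.
have [rB rE] := r_hat_lift; have [fB fE] := funitl_lift.
apply: bg_hom_fiber => //.
- move=> g g' h u a i i' j u' a' hu ha hu' ha'.
  rewrite (fE _ _ _ _ _ hu ha) (fE _ _ _ _ _ hu' ha').
  rewrite (fE _ _ _ _ _ (degM hu hu') (degM ha ha')).
  move: hu hu' => [c -> c0] [c' -> _].
  rewrite [_ * cpure c' i](cpureM c g c' i) !rE (alg_homM (bg_r_hom A)).
  (* The crossed product twists c' by g, while moving r(c') across [a] twists it by g'; these agree
     because off the diagonal the coefficient [c] is 0. *)
  have [e|/eqP /c0 ->] := eqVneq g g'; last first.
    by rewrite (alg_hom0 (bg_r_hom A)) !mul0r.
  by rewrite e -!mulrA; congr (_ * _); rewrite !mulrA (bg_rE _ ha).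
- move=> g g' h u a hu ha; rewrite (fE _ _ _ _ _ hu ha).
  move: hu => [c -> c0]; rewrite rE.
  have [e|/eqP /c0 ->] := eqVneq g g'; last first.
    by rewrite (alg_hom0 (bg_r_hom A)) mul0r; exact: deg0.
  by rewrite e -[g']mul1g -[h]mul1g; exact: degM (bg_r_deg A c) ha.
- move=> b; rewrite (fE _ _ _ _ _ (bg_r_deg (cross B) b) (deg_one A)).
  by rewrite mulr1 rE.
- move=> b; rewrite (fE _ _ _ _ _ (deg_one (cross B)) (bg_s_deg A b)).
  by rewrite [1]/(cpure 1 1%g) rE (alg_hom1 (bg_r_hom A)) mul1r.
Qed.

Lemma funitr_hom : bg_hom (@funitr _ _ _ A).
Proof.
have [sB sE] := s_hat_lift; have [fB fE] := funitr_lift.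
apply: bg_hom_fiber => //.
- move=> g g' h a u i i' j a' u' ha hu ha' hu'.
  rewrite (fE _ _ _ _ _ ha hu) (fE _ _ _ _ _ ha' hu').
  rewrite (fE _ _ _ _ _ (degM ha ha') (degM hu hu')).
  move: hu hu' => [c -> _] [c' -> _].
  rewrite [_ * cpure c' i'](cpureM c g' c' i') !sE (alg_homM (bg_s_hom A)).
  by rewrite -!mulrA; congr (_ * _); rewrite !mulrA (bg_sE _ ha).
- move=> g g' h a u ha hu; rewrite (fE _ _ _ _ _ ha hu).
  move: hu => [c -> c0]; rewrite sE.
  have [e|/eqP /c0 ->] := eqVneq g' h; last first.
    by rewrite (alg_hom0 (bg_s_hom A)) mul0r; exact: deg0.
  by rewrite -e -[g]mul1g -[g']mul1g; exact: degM (bg_s_deg A c) ha.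
- move=> b; rewrite (fE _ _ _ _ _ (bg_r_deg A b) (deg_one (cross B))).
  by rewrite [1]/(cpure 1 1%g) sE (alg_hom1 (bg_s_hom A)) mul1r.
- move=> b; rewrite (fE _ _ _ _ _ (deg_one A) (bg_s_deg (cross B) b)).
  by rewrite mulr1 sE.
Qed.

End Counit.

Section Morphisms.
Variables (k : fieldType) (Gam : groupType) (B : gammaAlg k Gam).

Lemma bg_hom_id (A : bgAlg B) : bg_hom (id : A -> A).
Proof. by split. Qed.

Lemma bg_hom_comp (A C D : bgAlg B) (f : A -> C) (g : C -> D) :
  bg_hom f -> bg_hom g -> bg_hom (g \o f).
Proof.
move=> [[fB [f1 fM] fK] fd fr fs] [[gB [g1 gM] gK] gd gr gs].
split=> [|i j x /fd /gd //|b|b] /=; rewrite ?fr ?fs //.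
split=> [x y||c] /=; rewrite ?fB ?fK //.
by split=> [|x y] /=; rewrite ?f1 ?fM.
Qed.

Lemma map_mx_inverse (A C : bgAlg B) n (f : A -> C) (v w : 'M[A]_n) :
  bg_hom f -> mx_inverse v w -> mx_inverse (map_mx f v) (map_mx f w).
Proof.
move=> [fh _ _ _] [vw wv].
by split; rewrite -(map_mxM_hom _ _ fh) ?vw ?wv (map_mx1_hom _ fh).
Qed.

Lemma orth_matrix_map (A C : bgAlg B) n (gam : 'I_n -> Gam) (F G : 'M[B]_n)
  (f : A -> C) (v : 'M[A]_n) :
  bg_hom f -> orth_matrix gam F G v -> orth_matrix gam F G (map_mx f v).
Proof.
move=> hf [hv [w vw rel]]; have [fh fd fr fs] := hf.
split=> [i j|]; first by rewrite mxE; exact: fd.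
exists (map_mx f w); first exact: map_mx_inverse.
have -> : map_mx (bg_r C) G = map_mx f (map_mx (bg_r A) G).
  by apply/matrixP=> i j; rewrite !mxE fr.
have -> : map_mx (bg_s C) F = map_mx f (map_mx (bg_s A) F).
  by apply/matrixP=> i j; rewrite !mxE fs.
by rewrite map_trmx -!(map_mxM_hom _ _ fh) rel.
Qed.

Lemma universal_hom_eq (A C : bgAlg B) n (gam : 'I_n -> Gam) (F G : 'M[B]_n)
  (v : 'M[A]_n) (f g : A -> C) :
  is_universal_orth gam F G v -> bg_hom f -> bg_hom g ->
  (forall i j, f (v i j) = g (v i j)) -> f = g.
Proof.
move=> [hv univ] hf hg e.
have [h [_ uniq]] := univ C _ (orth_matrix_map hf hv).
rewrite -(uniq f) // -(uniq g) //; split=> //.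
by apply/matrixP=> i j; rewrite !mxE e.
Qed.

(* A is a retract of the algebra of words in r(b), s(b), v_ij and w_ij. *)
Lemma universal_orth_ind (A : bgAlg B) n (gam : 'I_n -> Gam) (F G : 'M[B]_n)
  (v w : 'M[A]_n) (P : A -> Prop) :
  is_universal_orth gam F G v -> mx_inverse v w ->
  (forall x y, P x -> P y -> P (x + y)) ->
  P 0 -> P 1 ->
  (forall b x, P x -> P (bg_r A b * x)) ->
  (forall b x, P x -> P (bg_s A b * x)) ->
  (forall i j x, P x -> P (v i j * x)) ->
  (forall i j x, P x -> P (w i j * x)) ->
  forall x, P x.
Proof.
move=> univ vw PD P0 P1 Pr Ps Pv Pw x.
have [[hv [w' vw' rel]] uex] := univ.
have ew : w' = w by exact: mx_inverse_uniq vw' vw.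
rewrite {w'}ew in vw' rel; pose M := Model hv vw rel.
have [f [[fh fv] _]] := uex _ _ (orth_orth gam F G).
have Ev_bg : bg_hom (Ev M : orth gam F G -> A).
  split; [exact: (Ev_hom M) | exact: (@Ev_deg _ _ _ _ _ _ _ M) | |].
    exact: (Ev_r M).
  exact: (Ev_s M).
(* Both sides are endomorphisms of [A] that fix [v], so universality identifies them. *)
have e : id = (Ev M : orth gam F G -> A) \o f.
  apply: (universal_hom_eq univ (@bg_hom_id A) (bg_hom_comp fh Ev_bg)) => i j /=.
  have /matrixP/(_ i j) := fv; rewrite mxE => ->.
  by have /matrixP/(_ i j) := Ev_v M; rewrite mxE.
have -> : x = Ev M (f x) by exact: (congr1 (@^~ x) e).
move: (f x : orth_alg gam F G) => u.
rewrite (Ev_sum u) (zmod_morphism_sum _ _ (EvB M)).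
apply: big_ind => // -[c s] _ /=; rewrite Ev_pure /ev /=.
(* The scalar coefficient of a word is a value of [r], so closure under r(b) absorbs it. *)
rewrite -(alg_homK (bg_r_hom A)); apply: (Pr).
elim: s => [|l s IH]; first by rewrite big_nil.
by rewrite big_cons; case: l => [[b|b]|[[i j]|[i j]]] /=; auto.
Qed.

End Morphisms.

(** * The matrices defining comultiplication, counit and antipode *)

Section NablaOdd.
Variables (k : fieldType) (Gam : groupType) (B : gammaAlg k Gam).
Variables (n : nat) (gam : 'I_n -> Gam) (F F' G : 'M[B]_n).
Hypotheses (FF' : mx_inverse F F') (F_odd : is_nabla_conj gam F G).

(** The (i, j) entry of nabla F nabla is gam_i(F_ij) times the group element gam_i gam_j; comparing
    coefficients with G_ij at e and at gam_i gam_j gives the claim. *)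
Lemma nabla_oddE i j :
  G i j = act (gam i) (F i j) /\
  (F i j = 0 /\ G i j = 0 \/ (gam i * gam j = 1)%g).
Proof.
have e : cpure (act (gam i) (F i j)) (gam i * gam j)%g = cpure (G i j) 1%g.
  have /matrixP/(_ i j) := F_odd.
  rewrite /nabla mul_mx_diag mul_diag_mx !mxE /cross_emb !cpureM.
  by rewrite mul1r mulg1 (alg_hom1 (act_hom _)) mulr1.
have e1 := congr1 (cross_coef 1%g) e; have e2 := congr1 (cross_coef (gam i * gam j)%g) e.
rewrite !cross_coefE !eqxx in e1 e2; have [ij|/eqP ij] := eqVneq (gam i * gam j)%g 1%g.
  by rewrite ij eqxx in e1; split; [rewrite e1 | right].
have n1 : (gam i * gam j == 1)%g = false by exact/eqP.
rewrite n1 in e1; rewrite eq_sym n1 in e2; rewrite -e1 e2; split=> //; left; split=> //.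
by rewrite -[F i j]act1 -(mulVg (gam i)) actM e2 (alg_hom0 (act_hom _)).
Qed.

Lemma nabla_odd_actF i j : F i j = act (gam j) (G i j).
Proof.
have [-> [[-> _]|ij]] := nabla_oddE i j; first by rewrite !(alg_hom0 (act_hom _)).
by rewrite -actM -(mulg1_eq ij) mulVg act1.
Qed.

(* G = nabla F nabla has inverse nabla^-1 F^-1 nabla^-1. *)
Lemma nabla_odd_inv : exists G' : 'M[B]_n, mx_inverse G G'.
Proof.
(* [R] and [L] hold the coefficients of nabla^-1 F' nabla^-1 with group elements written on the
   right and on the left. Oddness of [F'] is not known beforehand, so [R] is shown to be a right
   inverse and [L] a left inverse, and the two then agree. *)
pose R : 'M[B]_n := \matrix_(i, j) act (gam i)^-1%g (F' i j).
pose L : 'M[B]_n := \matrix_(i, j) act (gam j) (F' i j).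
have [h1 h2] := FF'.
have act_delta g (i j : 'I_n) : act g ((1%:M : 'M[B]_n) i j) = (1%:M : 'M[B]_n) i j.
  rewrite mxE; case: eqP => _ /=; first exact: (alg_hom1 (act_hom g)).
  exact: (alg_hom0 (act_hom g)).
have act_sum g (E : 'I_n -> B) : act g (\sum_l E l) = \sum_l act g (E l).
  have [gB _ _] : alg_hom (act g : B -> B) := act_hom g.
  exact: zmod_morphism_sum gB.
have GR : G *m R = 1%:M.
  apply/matrixP=> i j; rewrite -(act_delta (gam i)) -h1 !mxE act_sum.
  apply: eq_bigr => l _; rewrite mxE (alg_homM (act_hom _)).
  have [-> [[-> _]|il]] := nabla_oddE i l.
    by rewrite (alg_hom0 (act_hom _)) !mul0r.
  by rewrite -(mulg1_eq il) invgK.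
have LG : L *m G = 1%:M.
  apply/matrixP=> i j; rewrite -(act_delta (gam j)^-1%g) -h2 !mxE act_sum.
  apply: eq_bigr => l _; rewrite mxE (alg_homM (act_hom _)).
  have [-> [[-> _]|lj]] := nabla_oddE l j.
    by rewrite !(alg_hom0 (act_hom _)) !mulr0.
  by rewrite -(mulg1_eq lj) !invgK.
exists R; split=> //.
by rewrite -[R]mul1mx -LG -[L *m G *m R]mulmxA GR mulmx1.
Qed.

(** Here r = s, and the relation G nabla^-1 = nabla F is a rewriting of G = nabla F nabla. *)
Lemma orth_matrix_cross :
  orth_matrix gam F G (diag_mx (\row_i cpure 1 (gam i)) : 'M[cross B]_n).
Proof.
split=> [i j|].
  rewrite !mxE; case: eqP => [->|_]; last exact: deg0.
  by exists 1.
exists (diag_mx (\row_i cpure 1 (gam i)^-1%g)).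
  split; rewrite mulmx_diag; apply/matrixP=> i j; rewrite !mxE cpureM;
    by rewrite mul1r (alg_hom1 (act_hom _)) ?mulgV ?mulVg.
rewrite tr_diag_mx mul_mx_diag mul_diag_mx; apply/matrixP=> i j; rewrite !mxE.
rewrite [bg_r _ _ * _](cpureM (G i j) 1%g) [_ * bg_s _ _](cpureM 1 (gam i)).
rewrite (alg_hom1 (act_hom _)) mulr1 mul1r mul1g mulg1.
have [-> [[-> _]|ij]] := nabla_oddE i j.
  by rewrite (alg_hom0 (act_hom _)) !(zmod_morphism0 (@cpure_zmod _ _ B _)).
by rewrite -(mulg1_eq ij) invgK.
Qed.

Section Orth.
Variables (A : bgAlg B) (v w : 'M[A]_n).
Hypotheses (hv : orth_matrix gam F G v) (vw : mx_inverse v w).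

Let v_deg i j : deg A (gam i) (gam j) (v i j).
Proof. by case: hv. Qed.
Let w_deg i j : deg A (gam j)^-1%g (gam i)^-1%g (w i j).
Proof. exact: inv_deg v_deg vw i j. Qed.

(** [orth_matrix] hides its inverse behind an existential; uniqueness of inverses identifies it with
    [w]. *)
Lemma orth_matrix_rel :
  map_mx (bg_r A) G *m w^T = v *m map_mx (bg_s A) F.
Proof. by have [_ [w' vw' rel]] := hv; rewrite -(mx_inverse_uniq vw' vw). Qed.

Definition comul_mx : 'M[fiber A A]_n :=
  \matrix_(i, j) \sum_l fpure (v i l) (v l j).
(** Formally [comul_mx] is the product of v (x) 1 and 1 (x) v, whose inverse is 1 (x) w times w (x)
    1; this reverses the summation indices. These factors need not be matching tensors, so the
    inverse is verified on expanded sums. *)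
Definition comul_inv : 'M[fiber A A]_n :=
  \matrix_(i, j) \sum_l fpure (w l j) (w i l).

Let vw_deg i l j : deg A (gam i * (gam j)^-1)%g 1%g (v i l * w l j).
Proof. by have := degM (v_deg i l) (w_deg l j); rewrite mulgV. Qed.
Let wv_deg i l j : deg A 1%g ((gam i)^-1 * gam j)%g (w i l * v l j).
Proof. by have := degM (w_deg i l) (v_deg l j); rewrite mulVg. Qed.
Let vwE i j : \sum_l v i l * w l j = (1%:M : 'M[A]_n) i j.
Proof. by have [<- _] := vw; rewrite mxE. Qed.
Let wvE i j : \sum_l w i l * v l j = (1%:M : 'M[A]_n) i j.
Proof. by have [_ <-] := vw; rewrite mxE. Qed.
Let fpure_deltal (l p : 'I_n) (x : A) :
  fpure ((1%:M : 'M[A]_n) l p) x = if l == p then fpure 1 x else 0.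
Proof. by rewrite mxE; case: eqP => _ //=; exact: fpure0l. Qed.
Let fpure_deltar (l p : 'I_n) (x : A) :
  fpure x ((1%:M : 'M[A]_n) l p) = if l == p then fpure x 1 else 0.
Proof. by rewrite mxE; case: eqP => _ //=; exact: fpure0r. Qed.
Let fpure_delta i j :
  fpure ((1%:M : 'M[A]_n) i j) (1 : A) = (1%:M : 'M[fiber A A]_n) i j.
Proof. by rewrite fpure_deltal mxE; case: eqP => _ //=; exact: fpure1. Qed.
Let fpure_delta' i j :
  fpure (1 : A) ((1%:M : 'M[A]_n) i j) = (1%:M : 'M[fiber A A]_n) i j.
Proof. by rewrite fpure_deltar mxE; case: eqP => _ //=; exact: fpure1. Qed.

Lemma comul_mx_inverse : mx_inverse comul_mx comul_inv.
Proof.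
split; apply/matrixP=> i j; rewrite mxE.
  transitivity (\sum_(l < n) \sum_(p < n) \sum_(m < n)
      fpure (v i l * w p j) (v l m * w m p) : fiber A A).
    under eq_bigr do rewrite !mxE big_distrlr.
    rewrite exchange_big; apply: eq_bigr => l _.
    rewrite exchange_big; apply: eq_bigr => p _; apply: eq_bigr => m _.
    exact: (fpureM (v_deg i l) (v_deg l m) (w_deg p j) (w_deg m p)).
  rewrite -fpure_delta -vwE (fpure_suml (fun l => vw_deg i l j) (deg_one A)).
  (* The sum over m in the second leg is entry (l, p) of v w, so only p = l survives. *)
  apply: eq_bigr => l _; rewrite (bigD1 l) //= [X in _ + X]big1 => [|p pl].
    rewrite addr0.
    rewrite -(fpure_sumr (degM (v_deg i l) (w_deg l j)) (fun m => vw_deg l m l)).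
    by rewrite vwE fpure_deltar eqxx.
  rewrite -(fpure_sumr (degM (v_deg i l) (w_deg p j)) (fun m => vw_deg l m p)).
  by rewrite vwE fpure_deltar eq_sym (negPf pl).
transitivity (\sum_(l < n) \sum_(p < n) \sum_(m < n)
    fpure (w l m * v m p) (w i l * v p j) : fiber A A).
  under eq_bigr do rewrite !mxE big_distrlr.
  rewrite exchange_big; apply: eq_bigr => l _.
  rewrite exchange_big; apply: eq_bigr => p _; apply: eq_bigr => m _.
  exact: (fpureM (w_deg l m) (w_deg i l) (v_deg m p) (v_deg p j)).
rewrite -fpure_delta' -wvE (fpure_sumr (deg_one A) (fun l => wv_deg i l j)).
apply: eq_bigr => l _; rewrite (bigD1 l) //= [X in _ + X]big1 => [|p pl].
  rewrite addr0.
  rewrite -(fpure_suml (fun m => wv_deg l m l) (degM (w_deg i l) (v_deg l j))).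
  by rewrite wvE fpure_deltal eqxx.
rewrite -(fpure_suml (fun m => wv_deg l m p) (degM (w_deg i l) (v_deg p j))).
by rewrite wvE fpure_deltal eq_sym (negPf pl).
Qed.

(** The relation for v is used once in each leg. In the first it turns r(G) w^T into v s(F); then
    v_ip s(F_pl) = s(G_pl) v_ip, and balancing carries s(G_pl) over as r(G_pl) to the second leg,
    where the relation applies again. *)
Lemma orth_matrix_comul : orth_matrix gam F G comul_mx.
Proof.
split=> [i j|].
  rewrite mxE; apply: deg_sum => l _; exact: deg_fpure (v_deg i l) (v_deg l j).
exists comul_inv; first exact: comul_mx_inverse.
(* Splitting a sum inside one leg requires a degree independent of the summation index; a nonzero
   G_im forces gam_m^-1 = gam_i. *)
have rG_deg x h i m :
    deg A (gam m)^-1%g h x -> deg A (gam i) h (bg_r A (G i m) * x).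
  move=> hx; have [_ [[_ ->]|im]] := nabla_oddE i m.
    by rewrite (alg_hom0 (bg_r_hom A)) mul0r; exact: deg0.
  by have := degM (bg_r_deg A (G i m)) hx; rewrite !mul1g -(mulg1_eq im) invgK.
have sF_deg i p l : deg A (gam i) (gam l)^-1%g (v i p * bg_s A (F p l)).
  have [_ [[-> _]|pl]] := nabla_oddE p l.
    by rewrite (alg_hom0 (bg_s_hom A)) mulr0; exact: deg0.
  have := degM (v_deg i p) (bg_s_deg A (F p l)).
  by rewrite !mulg1 -(mulg1_eq pl) invgK.
have relE i j : \sum_l bg_r A (G i l) * w j l = \sum_l v i l * bg_s A (F l j).
  have /matrixP/(_ i j) := orth_matrix_rel; rewrite !mxE.
  by under eq_bigr do rewrite !mxE; under [RHS]eq_bigr do rewrite mxE.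
apply/matrixP=> i j; rewrite [LHS]mxE [RHS]mxE.
transitivity (\sum_l fpure (\sum_m bg_r A (G i m) * w l m) (w j l) : fiber A A).
  under eq_bigr => m _ do
    rewrite [X in X * _]mxE [X in _ * X]mxE [X in _ * X]mxE mulr_sumr.
  rewrite exchange_big; apply: eq_bigr => l _.
  rewrite (fpure_suml (fun m => rG_deg _ _ i m (w_deg l m)) (w_deg j l)).
  by apply: eq_bigr => m _; exact: fiber_rM (w_deg l m) (w_deg j l).
transitivity (\sum_p fpure (v i p) (\sum_l bg_r A (G p l) * w j l) : fiber A A).
  transitivity (\sum_l \sum_p fpure (v i p * bg_s A (F p l)) (w j l) : fiber A A).
    apply: eq_bigr => l _; rewrite relE.
    exact: (fpure_suml (fun p => sF_deg i p l) (w_deg j l)).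
  rewrite exchange_big; apply: eq_bigr => p _.
  rewrite (fpure_sumr (v_deg i p) (fun l => rG_deg _ _ p l (w_deg j l))).
  apply: eq_bigr => l _; rewrite (bg_sE _ (v_deg i p)).
  have [<- [[_ ->]|pl]] := nabla_oddE p l.
    by rewrite (alg_hom0 (bg_s_hom A)) (alg_hom0 (bg_r_hom A)) !mul0r fpure0l fpure0r.
  by apply: fpure_bal (v_deg i p) _; rewrite -[gam p]invgK (mulg1_eq pl); exact: w_deg.
under [RHS]eq_bigr => q _ do rewrite [X in X * _]mxE [X in _ * X]mxE mulr_suml.
rewrite exchange_big; apply: eq_bigr => p _; rewrite relE.
rewrite (fpure_sumr (v_deg i p) (fun q => sF_deg p q j)).
by apply: eq_bigr => q _; symmetry; exact: fiber_Ms (v_deg i p) (v_deg p q).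
Qed.

Lemma bg_r_mx_inverse (H H' : 'M[B]_n) :
  mx_inverse H H' -> mx_inverse (map_mx (bg_r A) H) (map_mx (bg_r A) H').
Proof.
move=> [h h']; have rh := bg_r_hom A.
by split; rewrite -(map_mxM_hom _ _ rh) ?h ?h' (map_mx1_hom _ rh).
Qed.

Lemma bg_s_mx_inverse (H H' : 'M[B]_n) :
  mx_inverse H H' -> mx_inverse (map_mx (bg_s A) H) (map_mx (bg_s A) H').
Proof.
move=> [h h']; have sh := bg_s_hom A.
by split; rewrite -(map_mxM_hom _ _ sh) ?h ?h' (map_mx1_hom _ sh).
Qed.

(* The relation r(G) w^T = v s(F) exhibits s(F)^-1 w r(G) as the inverse of w^T;
   over the opposite algebra its transpose is the inverse of w. *)
Definition invtr_mx : 'M[A]_n := map_mx (bg_s A) F' *m w *m map_mx (bg_r A) G.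

(** The relation and w v = 1 make [invtr_mx] a left inverse of w^T. For the other side, inverting
    r(G) writes w^T as r(G') v s(F), a product of invertible matrices. *)
Lemma invtr_mxP : mx_inverse w^T invtr_mx.
Proof.
have [G' /bg_r_mx_inverse[_ G'G]] := nabla_odd_inv.
have [FF'A F'FA] := bg_s_mx_inverse FF'; have [v_w w_v] := vw.
have wE : w^T = map_mx (bg_r A) G' *m v *m map_mx (bg_s A) F.
  by rewrite -[RHS]mulmxA -orth_matrix_rel mulmxA G'G mul1mx.
split; last by rewrite -mulmxA orth_matrix_rel mulmxA -(mulmxA _ w) w_v mulmx1.
rewrite wE /invtr_mx -!mulmxA (mulmxA _ _ (w *m _)) FF'A mul1mx.
by rewrite (mulmxA v) v_w mul1mx.
Qed.

(** Rebuilding [w] entrywise makes matrix products use the multiplication of [coop A]. *)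
Definition antipode_mx : 'M[coop A]_n := \matrix_(i, j) w i j.
Definition antipode_inv : 'M[coop A]_n := \matrix_(i, j) invtr_mx j i.

Let antipode_mxE i j : antipode_mx i j = w i j.
Proof. exact: mxE. Qed.
Let antipode_invE i j : antipode_inv i j = invtr_mx j i.
Proof. exact: mxE. Qed.
Let trE i j : w^T i j = w j i.
Proof. exact: mxE. Qed.

Lemma antipode_mx_inverse : mx_inverse antipode_mx antipode_inv.
Proof.
have [wX Xw] := invtr_mxP; split; apply/matrixP=> i j.
  transitivity ((1%:M : 'M[A]_n) j i); last by rewrite !mxE eq_sym.
  rewrite -Xw [LHS]mxE [RHS]mxE; apply: eq_bigr => l _.
  by rewrite antipode_mxE antipode_invE trE.
transitivity ((1%:M : 'M[A]_n) j i); last by rewrite !mxE eq_sym.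
rewrite -wX [LHS]mxE [RHS]mxE; apply: eq_bigr => l _.
by rewrite antipode_mxE antipode_invE trE.
Qed.

Lemma antipode_deg i j : deg (coop A) (gam i) (gam j) (antipode_mx i j).
Proof. by rewrite mxE; exact: w_deg. Qed.

(** Write X for [invtr_mx]. Read in [A], the left side has summands X_mj s(G_im) = s(F_im) X_mj and
    the right side r(F_mj) w_im = w_im r(G_mj). The relation thus becomes s(F) X = w r(G), which
    holds by the choice of X. *)
Lemma orth_matrix_antipode : orth_matrix gam F G antipode_mx.
Proof.
split; first exact: antipode_deg.
exists antipode_inv; first exact: antipode_mx_inverse.
have X_deg m j : deg A (gam j) (gam m) (invtr_mx m j).
  have := inv_deg antipode_deg antipode_mx_inverse j m.
  by rewrite mxE [deg _ _ _ _]/(deg A _ _ _) !invgK.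
have sFX : map_mx (bg_s A) F *m invtr_mx = w *m map_mx (bg_r A) G.
  by have [FF'A _] := bg_s_mx_inverse FF'; rewrite /invtr_mx !mulmxA FF'A mul1mx.
have coop_rE i j : map_mx (bg_r (coop A)) G i j = (bg_s A (G i j) : coop A).
  exact: mxE.
have coop_sE i j : map_mx (bg_s (coop A)) F i j = (bg_r A (F i j) : coop A).
  exact: mxE.
have sFE i j : map_mx (bg_s A) F i j = bg_s A (F i j) by exact: mxE.
have rGE i j : map_mx (bg_r A) G i j = bg_r A (G i j) by exact: mxE.
have invE i j : antipode_inv^T i j = invtr_mx i j by rewrite mxE antipode_invE.
apply/matrixP=> i j.
transitivity ((map_mx (bg_s A) F *m invtr_mx) i j).
  rewrite [LHS]mxE [RHS]mxE; apply: eq_bigr => m _.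
  rewrite coop_rE invE sFE (nabla_odd_actF i m).
  exact: (bg_sE _ (X_deg m j)).
rewrite sFX [LHS]mxE [RHS]mxE; apply: eq_bigr => m _.
rewrite coop_sE rGE antipode_mxE (bg_rE _ (w_deg i m)).
have [-> _] := nabla_oddE m j.
by rewrite -actM mulVg act1.
Qed.

End Orth.

End NablaOdd.

(** * The antipode axioms on products *)

Section Antipode.
Variables (k : fieldType) (Gam : groupType) (B : gammaAlg k Gam) (A : bgAlg B).

Lemma cross_ind (P : cross B -> Prop) : P 0 ->
  (forall u w, P u -> P w -> P (u + w)) -> (forall b g, P (cpure b g)) ->
  forall u, P u.
Proof.
move=> P0 PD Pp u; have [l hl ->] := cross_deg_span u.
by rewrite big_seq; apply: big_ind => // p /hl[b -> _].
Qed.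

(** b is the sum of the coefficients of [u]. One b has to serve both clauses, because [r] need not
    be injective and b cannot be recovered from [r_hat A u]. *)
Lemma r_hat_mul (u : cross B) : exists2 b, r_hat A u = bg_r A b &
  forall c g, r_hat A (cpure c g * u) = bg_r A (c * act g b).
Proof.
have [rB rE] := r_hat_lift A; have rh := bg_r_hom A; move: u; apply: cross_ind.
- exists 0; first by rewrite (zmod_morphism0 rB) (alg_hom0 rh).
  move=> c g; rewrite mulr0 (zmod_morphism0 rB).
  by rewrite (alg_hom0 (act_hom g)) mulr0 (alg_hom0 rh).
- move=> u w [b ub uc] [d wd wc]; exists (b + d).
    by rewrite (zmod_morphismD rB) ub wd (alg_homD rh).
  move=> c g; rewrite mulrDr (zmod_morphismD rB) uc wc -(alg_homD rh) -mulrDr.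
  by rewrite (alg_homD (act_hom g)).
- move=> b h; exists b => [|c g]; first exact: rE.
  by rewrite [_ * _](cpureM c g b h) rE.
Qed.

Lemma s_check_mul (u : cross B) : exists2 b, s_check A u = bg_s A b &
  forall c g, s_check A (u * cpure c g) = bg_s A (act g^-1%g (b * c)).
Proof.
have [sB sE] := s_check_lift A; have sh := bg_s_hom A; move: u; apply: cross_ind.
- exists 0; first by rewrite (zmod_morphism0 sB) (alg_hom0 sh).
  move=> c g; rewrite !mul0r (zmod_morphism0 sB).
  by rewrite (alg_hom0 (act_hom _)) (alg_hom0 sh).
- move=> u w [b ub uc] [d wd wc]; exists (b + d).
    by rewrite (zmod_morphismD sB) ub wd (alg_homD sh).
  move=> c g; rewrite mulrDl (zmod_morphismD sB) uc wc -(alg_homD sh) mulrDl.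
  by rewrite (alg_homD (act_hom _)).
- move=> b h; exists (act h^-1%g b) => [|c g]; first exact: sE.
  rewrite [_ * _](cpureM b h c g) sE invgM actM (alg_homM (act_hom h^-1%g)).
  by rewrite -(actM h^-1%g) mulVg act1.
Qed.

Variables (S : A -> coop A) (S_hom : bg_hom S).
(** With target [A], products such as [T x * y] are formed in [A], and the multiplicativity of [S]
    becomes antimultiplicativity of [T]. *)
Let T (x : A) : A := S x.

Let TB : zmod_morphism T.
Proof. by have [[SB _ _] _ _ _] := S_hom; exact: SB. Qed.
Let T1 : T 1 = 1.
Proof. by have [[_ [S1 _] _] _ _ _] := S_hom; exact: S1. Qed.
Let TM x y : T (x * y) = T y * T x.
Proof. by have [[_ [_ SM] _] _ _ _] := S_hom; exact: SM. Qed.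
Let Tr b : T (bg_r A b) = bg_s A b.
Proof. by have [_ _ Sr _] := S_hom; exact: Sr. Qed.
Let Ts b : T (bg_s A b) = bg_r A b.
Proof. by have [_ _ _ Ss] := S_hom; exact: Ss. Qed.
Let T_deg g h x : deg A g h x -> deg A h^-1%g g^-1%g (T x).
Proof. by have [_ Sd _ _] := S_hom; exact: Sd. Qed.

Definition conv_left : fiber A A -> A := flift (fun a1 a2 => (S a1 : A) * a2).
Definition conv_right : fiber A A -> A := flift (fun a1 a2 => a1 * (S a2 : A)).

Lemma conv_left_lift : zmod_morphism conv_left /\
  forall g g' h a c, deg A g g' a -> deg A g' h c ->
    conv_left (fpure a c) = (S a : A) * c.
Proof.
apply: fliftE => [g g' h a a' c _ _ _|g g' h a c c' _ _ _|g g' h b a c _ _].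
- by rewrite -!/(T _) TB mulrBl.
- by rewrite mulrBr.
- by rewrite -!/(T _) TM Ts mulrA.
Qed.

(* S(r(b)) = s(b) sits on the right of a1 S(a2), which has degree (_, e) because
   S inverts the shared degree of a1 and a2. *)
Lemma conv_right_lift : zmod_morphism conv_right /\
  forall g g' h a c, deg A g g' a -> deg A g' h c ->
    conv_right (fpure a c) = a * (S c : A).
Proof.
apply: fliftE => [g g' h a a' c _ _ _|g g' h a c c' _ _ _|g g' h b a c ha hc].
- by rewrite mulrBl.
- by rewrite -!/(T _) TB mulrBr.
- rewrite -!/(T _) TM Tr mulrA (bg_sE b (degM ha (T_deg hc))).
  by rewrite mulgV act1 mulrA.
Qed.

(** For u = u_1 (x) u_2 and z = x (x) y, S(u_1 x) u_2 y = S(x) S(u_1) u_2 y. The middle factor sums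
    to s(b), which moves left across S(x), whose second degree is g^-1. *)
Lemma conv_leftM b u g h z : conv_left u = bg_s A b -> deg (fiber A A) g h z ->
  conv_left (u * z) = bg_s A (act g^-1%g b) * conv_left z.
Proof.
have [cB cE] := conv_left_lift => ub; move: z; apply: fiber_deg_ind.
- by rewrite mulr0 (zmod_morphism0 cB) mulr0.
- by move=> z z' _ _ IH IH'; rewrite mulrDr !(zmod_morphismD cB) IH IH' mulrDr.
move=> g' x y hx hy; rewrite (cE _ _ _ _ _ hx hy) -/(T x).
transitivity (T x * conv_left u * y); last first.
  by rewrite ub (bg_sE b (T_deg hx)) mulrA.
have [l hl ->] := fpure_gen u; rewrite mulr_suml !(zmod_morphism_sum _ _ cB).
rewrite mulr_sumr mulr_suml big_seq [RHS]big_seq.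
apply: eq_bigr => p /hl[i [i' [j [h1 h2]]]].
rewrite (fpureM h1 h2 hx hy) (cE _ _ _ _ _ h1 h2).
by rewrite (cE _ _ _ _ _ (degM h1 hx) (degM h2 hy)) -!/(T _) TM !mulrA.
Qed.

(** In x u_1 S(y u_2) = x u_1 S(u_2) S(y) the known value r(b) is inside when the new factor comes
    from the left; it moves out across x. *)
Lemma conv_rightM b u g h z : conv_right u = bg_r A b -> deg (fiber A A) g h z ->
  conv_right (z * u) = bg_r A (act g b) * conv_right z.
Proof.
have [cB cE] := conv_right_lift => ub; move: z; apply: fiber_deg_ind.
- by rewrite mul0r (zmod_morphism0 cB) mulr0.
- by move=> z z' _ _ IH IH'; rewrite mulrDl !(zmod_morphismD cB) IH IH' mulrDr.
move=> g' x y hx hy; rewrite (cE _ _ _ _ _ hx hy) -/(T y).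
transitivity (x * conv_right u * T y); last first.
  by rewrite ub (bg_rE b hx) mulrA.
have [l hl ->] := fpure_gen u; rewrite mulr_sumr !(zmod_morphism_sum _ _ cB).
rewrite mulr_sumr mulr_suml big_seq [RHS]big_seq.
apply: eq_bigr => p /hl[i [i' [j [h1 h2]]]].
rewrite (fpureM hx hy h1 h2) (cE _ _ _ _ _ h1 h2).
by rewrite (cE _ _ _ _ _ (degM hx h1) (degM hy h2)) -!/(T _) TM !mulrA.
Qed.

Variables (Delta : A -> fiber A A) (eps : A -> cross B).
Hypotheses (Delta_hom : bg_hom Delta) (eps_hom : bg_hom eps).

Definition antipode_left_at (a : A) : Prop :=
  conv_left (Delta a) = s_check A (eps a).
Definition antipode_right_at (a : A) : Prop :=
  conv_right (Delta a) = r_hat A (eps a).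

(** Both sides obey one rule: a right factor of degree (g, h) replaces s(b) by s(g^-1 b) and
    multiplies it by the value at that factor, by [conv_leftM] and [s_check_mul]. *)
Lemma antipode_leftM g h a a' : deg A g h a' ->
  antipode_left_at a -> antipode_left_at a' -> antipode_left_at (a * a').
Proof.
have [Dh Dd _ _] := Delta_hom; have [eh ed _ _] := eps_hom.
have [_ sE] := s_check_lift A; rewrite /antipode_left_at => ha' ha.
rewrite (alg_homM Dh) (alg_homM eh).
have [b ub uM] := s_check_mul (eps a); rewrite ub in ha.
rewrite (conv_leftM ha (Dd _ _ _ ha')) => ->.
have [c -> _] := ed _ _ _ ha'; rewrite uM sE -(alg_homM (bg_s_hom A)).
by rewrite (alg_homM (act_hom _)).
Qed.

Lemma antipode_rightM g h a a' : deg A g h a' ->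
  antipode_right_at a -> antipode_right_at a' -> antipode_right_at (a' * a).
Proof.
have [Dh Dd _ _] := Delta_hom; have [eh ed _ _] := eps_hom.
have [_ rE] := r_hat_lift A; rewrite /antipode_right_at => ha' ha.
rewrite (alg_homM Dh) (alg_homM eh).
have [b ub uM] := r_hat_mul (eps a); rewrite ub in ha.
rewrite (conv_rightM ha (Dd _ _ _ ha')) => ->.
have [c -> _] := ed _ _ _ ha'; rewrite uM rE -(alg_homM (bg_r_hom A)).
by rewrite mulrC.
Qed.

Lemma antipode_leftD a a' :
  antipode_left_at a -> antipode_left_at a' -> antipode_left_at (a + a').
Proof.
have [Dh _ _ _] := Delta_hom; have [eh _ _ _] := eps_hom.
have [cB _] := conv_left_lift; have [sB _] := s_check_lift A.
rewrite /antipode_left_at (alg_homD Dh) (alg_homD eh) => ha ha'.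
by rewrite (zmod_morphismD cB) (zmod_morphismD sB) ha ha'.
Qed.

Lemma antipode_rightD a a' :
  antipode_right_at a -> antipode_right_at a' -> antipode_right_at (a + a').
Proof.
have [Dh _ _ _] := Delta_hom; have [eh _ _ _] := eps_hom.
have [cB _] := conv_right_lift; have [rB _] := r_hat_lift A.
rewrite /antipode_right_at (alg_homD Dh) (alg_homD eh) => ha ha'.
by rewrite (zmod_morphismD cB) (zmod_morphismD rB) ha ha'.
Qed.

Lemma antipode_left0 : antipode_left_at 0.
Proof.
have [Dh _ _ _] := Delta_hom; have [eh _ _ _] := eps_hom.
have [cB _] := conv_left_lift; have [sB _] := s_check_lift A.
by rewrite /antipode_left_at (alg_hom0 Dh) (alg_hom0 eh) (zmod_morphism0 cB)
  (zmod_morphism0 sB).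
Qed.

Lemma antipode_right0 : antipode_right_at 0.
Proof.
have [Dh _ _ _] := Delta_hom; have [eh _ _ _] := eps_hom.
have [cB _] := conv_right_lift; have [rB _] := r_hat_lift A.
by rewrite /antipode_right_at (alg_hom0 Dh) (alg_hom0 eh) (zmod_morphism0 cB)
  (zmod_morphism0 rB).
Qed.

Lemma antipode_left_r b : antipode_left_at (bg_r A b).
Proof.
have [_ _ Dr _] := Delta_hom; have [_ _ er _] := eps_hom.
have [_ cE] := conv_left_lift; have [_ sE] := s_check_lift A.
rewrite /antipode_left_at Dr er.
rewrite [LHS](cE _ _ _ _ _ (bg_r_deg A b) (deg_one A)) [LHS]mulr1 [LHS]Tr.
by rewrite [RHS]sE invg1 act1.
Qed.

Lemma antipode_left_s b : antipode_left_at (bg_s A b).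
Proof.
have [_ _ _ Ds] := Delta_hom; have [_ _ _ es] := eps_hom.
have [_ cE] := conv_left_lift; have [_ sE] := s_check_lift A.
rewrite /antipode_left_at Ds es.
rewrite [LHS](cE _ _ _ _ _ (deg_one A) (bg_s_deg A b)) -/(T 1) T1 mul1r.
by rewrite [RHS]sE invg1 act1.
Qed.

Lemma antipode_right_r b : antipode_right_at (bg_r A b).
Proof.
have [_ _ Dr _] := Delta_hom; have [_ _ er _] := eps_hom.
have [_ cE] := conv_right_lift; have [_ rE] := r_hat_lift A.
rewrite /antipode_right_at Dr er.
by rewrite [LHS](cE _ _ _ _ _ (bg_r_deg A b) (deg_one A)) -/(T 1) T1 mulr1 [RHS]rE.
Qed.

Lemma antipode_right_s b : antipode_right_at (bg_s A b).
Proof.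
have [_ _ _ Ds] := Delta_hom; have [_ _ _ es] := eps_hom.
have [_ cE] := conv_right_lift; have [_ rE] := r_hat_lift A.
rewrite /antipode_right_at Ds es.
by rewrite [LHS](cE _ _ _ _ _ (deg_one A) (bg_s_deg A b)) -/(T _) Ts mul1r [RHS]rE.
Qed.

End Antipode.

(** * The Hopf algebroid structure *)

Section HopfStructure.
Variables (k : fieldType) (Gam : groupType) (B : gammaAlg k Gam).
Variables (n : nat) (gam : 'I_n -> Gam) (F F' G : 'M[B]_n).
Hypotheses (FF' : mx_inverse F F') (F_odd : is_nabla_conj gam F G).
Variables (A : bgAlg B) (v w : 'M[A]_n).
Hypotheses (A_univ : is_universal_orth gam F G v) (vw : mx_inverse v w).
Variables (Delta : A -> fiber A A) (eps : A -> cross B) (S : A -> coop A).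
Hypotheses (Delta_hom : bg_hom Delta) (eps_hom : bg_hom eps) (S_hom : bg_hom S).
Hypotheses (Delta_v : forall i j, Delta (v i j) = \sum_l fpure (v i l) (v l j))
  (eps_v : forall i j, eps (v i j) = cpure 1 (gam i) *+ (i == j))
  (S_v : forall i j, S (v i j) = w i j).

Let hv : orth_matrix gam F G v.
Proof. by case: A_univ. Qed.
Let v_deg i j : deg A (gam i) (gam j) (v i j).
Proof. by case: hv. Qed.
Let w_deg i j : deg A (gam j)^-1%g (gam i)^-1%g (w i j).
Proof. exact: inv_deg v_deg vw i j. Qed.

(** Values on [w] are forced: a morphism maps [w] to an inverse of the image of [v], and inverses
    are unique. The same argument determines [eps] and [S] on [w]. *)
Lemma Delta_w i j : Delta (w i j) = \sum_l fpure (w l j) (w i l).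
Proof.
have Dv : map_mx Delta v = comul_mx v.
  by apply/matrixP=> p q; rewrite [LHS]mxE [RHS]mxE Delta_v.
have h : mx_inverse (comul_mx v) (map_mx Delta w).
  by rewrite -Dv; exact: map_mx_inverse Delta_hom vw.
have /matrixP/(_ i j) := mx_inverse_uniq h (comul_mx_inverse hv vw).
by rewrite [LHS]mxE [RHS]mxE.
Qed.

Lemma eps_w i j : eps (w i j) = cpure 1 (gam i)^-1%g *+ (i == j).
Proof.
pose D : 'M[cross B]_n := diag_mx (\row_i cpure 1 (gam i)).
pose D' : 'M[cross B]_n := diag_mx (\row_i cpure 1 (gam i)^-1%g).
have ev : map_mx eps v = D by apply/matrixP=> p q; rewrite !mxE eps_v.
have h : mx_inverse D (map_mx eps w).
  by rewrite -ev; exact: map_mx_inverse eps_hom vw.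
have h' : mx_inverse D D'.
  by split; rewrite mulmx_diag; apply/matrixP=> p q; rewrite !mxE cpureM;
    rewrite mul1r (alg_hom1 (act_hom _)) ?mulgV ?mulVg.
by have /matrixP/(_ i j) := mx_inverse_uniq h h'; rewrite !mxE.
Qed.

Lemma S_w i j : S (w i j) = invtr_mx F' G w j i.
Proof.
have Sv : map_mx S v = antipode_mx w.
  by apply/matrixP=> p q; rewrite [LHS]mxE [RHS]mxE S_v.
have h : mx_inverse (antipode_mx w) (map_mx S w).
  by rewrite -Sv; exact: map_mx_inverse S_hom vw.
have /matrixP/(_ i j) := mx_inverse_uniq h (antipode_mx_inverse FF' F_odd hv vw).
by rewrite [LHS]mxE [RHS]mxE.
Qed.

Let s_check_delta g (i j : 'I_n) :
  s_check A (cpure 1 g *+ (i == j)) = (1%:M : 'M[A]_n) i j.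
Proof.
have [sB sE] := s_check_lift A; rewrite mxE; case: eqP => _ /=.
  by rewrite sE (alg_hom1 (act_hom _)) (alg_hom1 (bg_s_hom A)).
exact: (zmod_morphism0 sB).
Qed.
Let r_hat_delta g (i j : 'I_n) :
  r_hat A (cpure 1 g *+ (i == j)) = (1%:M : 'M[A]_n) i j.
Proof.
have [rB rE] := r_hat_lift A; rewrite mxE; case: eqP => _ /=.
  by rewrite rE (alg_hom1 (bg_r_hom A)).
exact: (zmod_morphism0 rB).
Qed.
Let delta_sym (i j : 'I_n) : (1%:M : 'M[A]_n) i j = (1%:M : 'M[A]_n) j i.
Proof. by rewrite !mxE eq_sym. Qed.

(** On [v] the two antipode axioms are the identities w v = 1 and v w = 1; on [w] they are X w^T = 1
    and w^T X = 1 for X = [invtr_mx]. *)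
Lemma antipode_left_v i j : antipode_left_at S Delta eps (v i j).
Proof.
have [cB cE] := conv_left_lift S_hom; have [_ wv] := vw.
rewrite /antipode_left_at Delta_v eps_v s_check_delta -wv.
rewrite (zmod_morphism_sum _ _ cB) [RHS]mxE; apply: eq_bigr => l _.
by rewrite (cE _ _ _ _ _ (v_deg i l) (v_deg l j)) S_v.
Qed.

Lemma antipode_right_v i j : antipode_right_at S Delta eps (v i j).
Proof.
have [cB cE] := conv_right_lift S_hom; have [v_w _] := vw.
rewrite /antipode_right_at Delta_v eps_v r_hat_delta -v_w.
rewrite (zmod_morphism_sum _ _ cB) [RHS]mxE; apply: eq_bigr => l _.
by rewrite (cE _ _ _ _ _ (v_deg i l) (v_deg l j)) S_v.
Qed.

Lemma antipode_left_w i j : antipode_left_at S Delta eps (w i j).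
Proof.
have [cB cE] := conv_left_lift S_hom.
have [_ Xw] := invtr_mxP FF' F_odd hv vw.
rewrite /antipode_left_at Delta_w eps_w s_check_delta delta_sym -Xw.
rewrite (zmod_morphism_sum _ _ cB) [RHS]mxE; apply: eq_bigr => l _.
by rewrite (cE _ _ _ _ _ (w_deg l j) (w_deg i l)) S_w [w^T _ _]mxE.
Qed.

Lemma antipode_right_w i j : antipode_right_at S Delta eps (w i j).
Proof.
have [cB cE] := conv_right_lift S_hom.
have [wX _] := invtr_mxP FF' F_odd hv vw.
rewrite /antipode_right_at Delta_w eps_w r_hat_delta delta_sym -wX.
rewrite (zmod_morphism_sum _ _ cB) [RHS]mxE; apply: eq_bigr => l _.
by rewrite (cE _ _ _ _ _ (w_deg l j) (w_deg i l)) S_w [w^T _ _]mxE.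
Qed.

Lemma antipode_left a : antipode_left_at S Delta eps a.
Proof.
have lM := antipode_leftM S_hom Delta_hom eps_hom.
have l1 : antipode_left_at S Delta eps 1.
  by rewrite -(alg_hom1 (bg_r_hom A)); exact: antipode_left_r.
(* [antipode_leftM] appends homogeneous factors on the right, whereas the induction over words adds
   generators on the left. Generalizing over a prefix [a'] lets each generator be absorbed into the
   prefix. *)
suff: forall a', antipode_left_at S Delta eps a' ->
    antipode_left_at S Delta eps (a' * a).
  by move=> /(_ 1 l1); rewrite mul1r.
move: a; apply: (universal_orth_ind A_univ vw).
- move=> x y hx hy a' ha'; rewrite mulrDr.
  by apply: antipode_leftD; [exact: S_hom| | |exact: hx|exact: hy].
- by move=> a' _; rewrite mulr0; exact: antipode_left0.
- by move=> a'; rewrite mulr1.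
- move=> b x hx a' ha'; rewrite mulrA; apply: hx.
  by apply: lM (bg_r_deg A b) ha' _; exact: antipode_left_r.
- move=> b x hx a' ha'; rewrite mulrA; apply: hx.
  by apply: lM (bg_s_deg A b) ha' _; exact: antipode_left_s.
- move=> i j x hx a' ha'; rewrite mulrA; apply: hx.
  by apply: lM (v_deg i j) ha' _; exact: antipode_left_v.
- move=> i j x hx a' ha'; rewrite mulrA; apply: hx.
  by apply: lM (w_deg i j) ha' _; exact: antipode_left_w.
Qed.

Lemma antipode_right a : antipode_right_at S Delta eps a.
Proof.
have rM := antipode_rightM S_hom Delta_hom eps_hom.
move: a; apply: (universal_orth_ind A_univ vw).
- by move=> x y; exact: antipode_rightD.
- exact: antipode_right0.
- by rewrite -(alg_hom1 (bg_r_hom A)); exact: antipode_right_r.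
- by move=> b x hx; apply: rM (bg_r_deg A b) hx _; exact: antipode_right_r.
- by move=> b x hx; apply: rM (bg_s_deg A b) hx _; exact: antipode_right_s.
- by move=> i j x hx; apply: rM (v_deg i j) hx _; exact: antipode_right_v.
- by move=> i j x hx; apply: rM (w_deg i j) hx _; exact: antipode_right_w.
Qed.

Lemma comul_coassoc a :
  fassoc (fmap Delta id (Delta a)) = fmap id Delta (Delta a).
Proof.
have id_hom := bg_hom_id A; have h1 := fmap_hom Delta_hom id_hom.
have h2 := fmap_hom id_hom Delta_hom.
have v2_deg i j : deg (fiber A A) (gam i) (gam j) (\sum_l fpure (v i l) (v l j)).
  by apply: deg_sum => l _; exact: deg_fpure (v_deg i l) (v_deg l j).
have sumE i l j : fpure (\sum_p fpure (v i p) (v p l) : fiber A A) (v l j) =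
    \sum_p fpure (fpure (v i p) (v p l) : fiber A A) (v l j).
  by rewrite (fpure_suml (fun p => deg_fpure (v_deg i p) (v_deg p l)) (v_deg l j)).
have := universal_hom_eq A_univ
  (bg_hom_comp Delta_hom (bg_hom_comp h1 (@fassoc_hom _ _ _ A A A)))
  (bg_hom_comp Delta_hom h2).
move=> /(_ _)/(congr1 (@^~ a)); apply=> i j /=.
rewrite Delta_v (zmod_morphism_sum _ _ (fmap_zmod id_hom Delta_hom)).
rewrite (zmod_morphism_sum _ _ (fmap_zmod Delta_hom id_hom)).
rewrite (zmod_morphism_sum _ _ (@fassoc_zmod _ _ _ A A A)).
transitivity (\sum_l \sum_p
    fpure (v i p) (fpure (v p l) (v l j) : fiber A A) : fiber A (fiber A A)).
  apply: eq_bigr => l _.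
  rewrite (fmapE Delta_hom id_hom (v_deg i l) (v_deg l j)) Delta_v sumE.
  rewrite (zmod_morphism_sum _ _ (@fassoc_zmod _ _ _ A A A)).
  by apply: eq_bigr => p _; exact: fassocE (v_deg i p) (v_deg p l) (v_deg l j).
rewrite exchange_big; apply: eq_bigr => p _.
rewrite (fmapE id_hom Delta_hom (v_deg i p) (v_deg p j)) Delta_v.
by rewrite (fpure_sumr (v_deg i p) (fun l => deg_fpure (v_deg p l) (v_deg l j))).
Qed.

Lemma counit_left a : funitl (fmap eps id (Delta a)) = a.
Proof.
have id_hom := bg_hom_id A; have h1 := fmap_hom eps_hom id_hom.
have [uB uE] := funitl_lift A.
have := universal_hom_eq A_univ
  (bg_hom_comp Delta_hom (bg_hom_comp h1 (funitl_hom A))) id_hom.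
move=> /(_ _)/(congr1 (@^~ a)); apply=> i j /=.
have eps_deg i' j' : deg (cross B) (gam i') (gam j') (eps (v i' j')).
  by have [_ ed _ _] := eps_hom; exact: ed.
rewrite Delta_v (zmod_morphism_sum _ _ (fmap_zmod eps_hom id_hom)).
rewrite (zmod_morphism_sum _ _ uB) (bigD1 i) //= big1 => [|l li];
  rewrite (fmapE eps_hom id_hom (v_deg i _) (v_deg _ j));
  rewrite (uE _ _ _ _ _ (eps_deg i _) (v_deg _ j)) eps_v r_hat_delta mxE.
  by rewrite eqxx mul1r addr0.
by rewrite eq_sym (negPf li) mul0r.
Qed.

Lemma counit_right a : funitr (fmap id eps (Delta a)) = a.
Proof.
have id_hom := bg_hom_id A; have h1 := fmap_hom id_hom eps_hom.
have [uB uE] := funitr_lift A; have [sB sE] := s_hat_lift A.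
have := universal_hom_eq A_univ
  (bg_hom_comp Delta_hom (bg_hom_comp h1 (funitr_hom A))) id_hom.
move=> /(_ _)/(congr1 (@^~ a)); apply=> i j /=.
have eps_deg i' j' : deg (cross B) (gam i') (gam j') (eps (v i' j')).
  by have [_ ed _ _] := eps_hom; exact: ed.
rewrite Delta_v (zmod_morphism_sum _ _ (fmap_zmod id_hom eps_hom)).
rewrite (zmod_morphism_sum _ _ uB) (bigD1 j) //= big1 => [|l lj];
  rewrite (fmapE id_hom eps_hom (v_deg i _) (v_deg _ j));
  rewrite (uE _ _ _ _ _ (v_deg i _) (eps_deg _ j)) eps_v.
  by rewrite eqxx sE (alg_hom1 (bg_s_hom A)) mul1r addr0.
by rewrite (negPf lj) (zmod_morphism0 sB) mul0r.
Qed.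

Lemma orth_is_hopf : is_hopf_algebroid (HopfData Delta eps S).
Proof.
do 2![split=> //]; [exact: comul_coassoc | exact: counit_left |
  exact: counit_right | exact: antipode_left | exact: antipode_right].
Qed.

End HopfStructure.

Theorem theorem2p4p2 (k : fieldType) (Gam : groupType) (B : gammaAlg k Gam)
    (n : nat) (gam : 'I_n -> Gam) (F G : 'M[B]_n)
    (F_inv : exists F' : 'M[B]_n, mx_inverse F F')
    (F_odd : is_nabla_conj gam F G)
    (A : bgAlg B) (v w : 'M[A]_n)
    (A_univ : is_universal_orth gam F G v)
    (v_inv : mx_inverse v w) :
  exists! D : hopf_data A,
    is_hopf_algebroid D /\
    [/\ forall i j, hDelta D (v i j) = \sum_l fpure (v i l) (v l j),
        forall i j, heps D (v i j) = cpure 1 (gam i) *+ (i == j) &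
        forall i j, hS D (v i j) = w i j].
Proof.
have [F' FF'] := F_inv; have [hv univ] := A_univ.
have [Delta [[Delta_hom Delta_mx] _]] := univ _ _ (orth_matrix_comul F_odd hv v_inv).
have [eps [[eps_hom eps_mx] _]] := univ _ _ (orth_matrix_cross F_odd).
have [S [[S_hom S_mx] _]] := univ _ _ (orth_matrix_antipode FF' F_odd hv v_inv).
have Delta_v i j : Delta (v i j) = \sum_l fpure (v i l) (v l j).
  by have /matrixP/(_ i j) := Delta_mx; rewrite [LHS]mxE [RHS]mxE.
have eps_v i j : eps (v i j) = cpure 1 (gam i) *+ (i == j).
  by have /matrixP/(_ i j) := eps_mx; rewrite !mxE.
have S_v i j : S (v i j) = w i j.
  by have /matrixP/(_ i j) := S_mx; rewrite [LHS]mxE [RHS]mxE.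
exists (HopfData Delta eps S); split; first (split; last by split).
  exact: (orth_is_hopf FF' F_odd A_univ v_inv).
move=> [Delta' eps' S'] [[[/= Delta_hom' eps_hom' S_hom'] _] [Dv ev Sv]].
congr HopfData; apply: (universal_hom_eq A_univ) => // i j.
- by rewrite Delta_v Dv.
- by rewrite eps_v ev.
- by rewrite S_v Sv.
Qed.
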